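(* Let $\mathbb{F}$ be a field of characteristic 0. Let $\mathcal{E}_5\colon\mathrm{TT}_5\to\mathrm{DD}_5$ be the expansion map for the pre-Jordan triple products $\langle a,b,c\rangle_1=(a\cdot b)\cdot c$ and $\langle a,b,c\rangle_2=a\cdot(b\cdot c)$, where $a\cdot b=a\succ b+b\prec a$, and let $E_5$ be the matrix representing $\mathcal{E}_5$ with respect to the ordered bases of monomials. The nullspace $N_5$ of $E_5$ (identified with $\ker\mathcal{E}_5$) has dimension 335, and it is generated as an $S_5$-module by the five elements $\mathrm{PJTS}_k(a,b,c,d,e)$, $k=1,\dots,5$, below, which are independent in the sense that none of them is a consequence of the others (none lies in the $S_5$-submodule of $\mathrm{TT}_5$ generated by the other four): $$\begin{aligned} \mathrm{PJTS}_1={}&\langle\langle a,b,c\rangle_1,d,e\rangle_1+\langle\langle b,a,c\rangle_1,d,e\rangle_1+\langle\langle c,a,b\rangle_2,d,e\rangle_1+\langle\langle c,b,a\rangle_2,d,e\rangle_1\\ &-\langle a,\langle b,c,d\rangle_1,e\rangle_1-\langle a,\langle c,b,d\rangle_1,e\rangle_1-\langle b,\langle a,c,d\rangle_1,e\rangle_1-\langle b,\langle c,a,d\rangle_1,e\rangle_1\\ &-\langle c,\langle a,b,d\rangle_1,e\rangle_1-\langle c,\langle b,a,d\rangle_1,e\rangle_1+\langle a,\langle c,b,d\rangle_2,e\rangle_1+\langle b,\langle c,a,d\rangle_2,e\rangle_1, \end{aligned}$$ $$\begin{aligned} \mathrm{PJTS}_2={}&\langle\langle b,d,a\rangle_1,c,e\rangle_2+\langle\langle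 b,d,c\rangle_1,a,e\rangle_2+\langle\langle a,b,d\rangle_2,c,e\rangle_2+\langle\langle c,b,d\rangle_2,a,e\rangle_2\\ &-\langle a,\langle b,d,c\rangle_1,e\rangle_2-\langle c,\langle b,d,a\rangle_1,e\rangle_2-\langle a,\langle c,b,d\rangle_2,e\rangle_2-\langle c,\langle a,b,d\rangle_2,e\rangle_2\\ &+\langle a,c,\langle b,d,e\rangle_1\rangle_1-\langle b,d,\langle a,c,e\rangle_1\rangle_1-\langle b,d,\langle c,a,e\rangle_1\rangle_1+\langle c,a,\langle b,d,e\rangle_1\rangle_1, \end{aligned}$$ $$\begin{aligned} \mathrm{PJTS}_3={}&\langle\langle b,c,d\rangle_1,a,e\rangle_1+\langle\langle d,b,c\rangle_2,a,e\rangle_1+\langle a,\langle b,c,d\rangle_1,e\rangle_1-\langle a,\langle b,c,d\rangle_1,e\rangle_2\\ &-\langle d,\langle b,c,a\rangle_1,e\rangle_2+\langle a,\langle d,b,c\rangle_2,e\rangle_1-\langle a,\langle d,b,c\rangle_2,e\rangle_2-\langle d,\langle a,b,c\rangle_2,e\rangle_2\\ &-\langle b,c,\langle a,d,e\rangle_1\rangle_1-\langle b,c,\langle d,a,e\rangle_1\rangle_1+\langle d,a,\langle b,c,e\rangle_1\rangle_2+\langle b,c,\langle a,d,e\rangle_2\rangle_1, \end{aligned}$$ $$\begin{aligned} \mathrm{PJTS}_4={}&\langle a,\langle b,c,d\rangle_1,e\rangle_2+\langle a,\langle c,b,d\rangle_1,e\rangle_2+\langle a,\langle d,b,c\rangle_2,e\rangle_2+\langle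 a,\langle d,c,b\rangle_2,e\rangle_2\\ &-\langle a,b,\langle c,d,e\rangle_1\rangle_2-\langle a,b,\langle d,c,e\rangle_1\rangle_2-\langle a,c,\langle b,d,e\rangle_1\rangle_2-\langle a,c,\langle d,b,e\rangle_1\rangle_2\\ &-\langle a,d,\langle b,c,e\rangle_1\rangle_2-\langle a,d,\langle c,b,e\rangle_1\rangle_2+\langle a,b,\langle d,c,e\rangle_2\rangle_2+\langle a,c,\langle d,b,e\rangle_2\rangle_2, \end{aligned}$$ $$\begin{aligned} \mathrm{PJTS}_5={}&\langle\langle a,c,b\rangle_1,d,e\rangle_2+\langle\langle a,c,d\rangle_1,b,e\rangle_2+\langle\langle c,a,b\rangle_1,d,e\rangle_2+\langle\langle c,a,d\rangle_1,b,e\rangle_2\\ &+\langle\langle c,d,b\rangle_1,a,e\rangle_2+\langle\langle d,a,b\rangle_1,c,e\rangle_2+\langle\langle d,a,c\rangle_1,b,e\rangle_2+\langle\langle d,b,a\rangle_1,c,e\rangle_2\\ &+\langle\langle d,b,c\rangle_1,a,e\rangle_2+\langle\langle d,c,b\rangle_1,a,e\rangle_2+\langle\langle a,d,b\rangle_2,c,e\rangle_2+\langle\langle b,a,c\rangle_2,d,e\rangle_2\\ &+\langle\langle b,c,a\rangle_2,d,e\rangle_2+\langle\langle b,c,d\rangle_2,a,e\rangle_2+\langle\langle b,d,a\rangle_2,c,e\rangle_2+\langle\langle b,d,c\rangle_2,a,e\rangle_2\\ &+\langle\langle c,d,a\rangle_2,b,e\rangle_2+\langle\langle c,d,b\rangle_2,a,e\rangle_2+\langle\langle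 d,a,c\rangle_2,b,e\rangle_2+\langle\langle d,c,a\rangle_2,b,e\rangle_2\\ &-\langle a,\langle b,c,d\rangle_1,e\rangle_1-\langle a,\langle b,d,c\rangle_1,e\rangle_1-\langle a,\langle c,b,d\rangle_1,e\rangle_1-\langle a,\langle c,d,b\rangle_1,e\rangle_1\\ &-\langle a,\langle d,b,c\rangle_1,e\rangle_1-\langle a,\langle d,c,b\rangle_1,e\rangle_1-\langle b,\langle a,c,d\rangle_1,e\rangle_1-\langle b,\langle a,d,c\rangle_1,e\rangle_1\\ &-\langle b,\langle c,a,d\rangle_1,e\rangle_1-\langle b,\langle c,d,a\rangle_1,e\rangle_1-\langle b,\langle d,a,c\rangle_1,e\rangle_1-\langle b,\langle d,c,a\rangle_1,e\rangle_1\\ &-\langle c,\langle a,b,d\rangle_1,e\rangle_1-\langle c,\langle a,d,b\rangle_1,e\rangle_1-\langle c,\langle b,a,d\rangle_1,e\rangle_1-\langle c,\langle b,d,a\rangle_1,e\rangle_1\\ &-\langle c,\langle d,a,b\rangle_1,e\rangle_1-\langle c,\langle d,b,a\rangle_1,e\rangle_1-\langle d,\langle a,b,c\rangle_1,e\rangle_1-\langle d,\langle a,c,b\rangle_1,e\rangle_1\\ &-\langle d,\langle b,a,c\rangle_1,e\rangle_1-\langle d,\langle b,c,a\rangle_1,e\rangle_1-\langle d,\langle c,a,b\rangle_1,e\rangle_1-\langle d,\langle c,b,a\rangle_1,e\rangle_1\\ &-\langle a,\langle d,b,c\rangle_1,e\rangle_2+\langle b,\langle a,d,c\rangle_1,e\rangle_2+\langle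 c,\langle a,d,b\rangle_1,e\rangle_2-\langle c,\langle d,b,a\rangle_1,e\rangle_2\\ &-\langle a,\langle c,d,b\rangle_2,e\rangle_2+\langle b,\langle c,a,d\rangle_2,e\rangle_2-\langle c,\langle a,d,b\rangle_2,e\rangle_2+\langle c,\langle b,a,d\rangle_2,e\rangle_2\\ &+\langle a,b,\langle c,d,e\rangle_1\rangle_1+\langle a,b,\langle d,c,e\rangle_1\rangle_1+\langle a,c,\langle d,b,e\rangle_1\rangle_1+\langle a,d,\langle b,c,e\rangle_1\rangle_1\\ &+\langle a,d,\langle c,b,e\rangle_1\rangle_1+\langle b,a,\langle c,d,e\rangle_1\rangle_1+\langle b,a,\langle d,c,e\rangle_1\rangle_1+\langle b,c,\langle d,a,e\rangle_1\rangle_1\\ &+\langle b,d,\langle a,c,e\rangle_1\rangle_1+\langle b,d,\langle c,a,e\rangle_1\rangle_1+\langle c,a,\langle d,b,e\rangle_1\rangle_1+\langle c,b,\langle d,a,e\rangle_1\rangle_1\\ &-\langle b,a,\langle c,d,e\rangle_1\rangle_2-\langle b,a,\langle d,c,e\rangle_1\rangle_2-\langle b,c,\langle a,d,e\rangle_1\rangle_2-\langle b,c,\langle d,a,e\rangle_1\rangle_2\\ &-\langle b,d,\langle a,c,e\rangle_1\rangle_2-\langle b,d,\langle c,a,e\rangle_1\rangle_2-\langle c,a,\langle d,b,e\rangle_2\rangle_2-\langle d,a,\langle c,b,e\rangle_2\rangle_2. \end{aligned}$$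
   Context: A dendriform dialgebra over $\mathbb{F}$ is a vector space with two bilinear operations $\prec,\succ$ satisfying, for all $x,y,z$: $(x\succ y)\prec z = x\succ(y\prec z)$; $(x\prec y)\prec z = x\prec(y\prec z)+x\prec(y\succ z)$; $x\succ(y\succ z)=(x\succ y)\succ z+(x\prec y)\succ z$. $\mathrm{DD}_n$ denotes the multilinear subspace of degree $n$ of the free dendriform dialgebra on $x_1,\dots,x_n$ over $\mathbb{F}$. $\mathrm{TT}_n$ ($n$ odd) denotes the multilinear subspace of degree $n$ of the free (nonassociative) algebra on $x_1,\dots,x_n$ with two trilinear operations $\langle x,y,z\rangle_1,\langle x,y,z\rangle_2$ and no relations. $S_n$ acts on both by permuting the variables, $\sigma\cdot x_i=x_{\sigma(i)}$. The expansion map $\mathcal{E}_n\colon\mathrm{TT}_n\to\mathrm{DD}_n$ is the linear map that replaces each occurrence of $\langle x,y,z\rangle_1$ by $(x\cdot y)\cdot z$ and each occurrence of $\langle x,y,z\rangle_2$ by $x\cdot(y\cdot z)$, where $x\cdot y=x\succ y+y\prec x$ is the pre-Jordan product. Its kernel is the space of multilinear identities of degree $n$ satisfied by the pre-Jordan triple products in the free dendriform dialgebra. The letters $a,b,c,d,e$ denote $x_1,\dots,x_5$. Monomial bases: $\mathrm{TT}_5$ has as basis the 1440 multilinear monomials in the two trilinear operations; $\mathrm{DD}_5$ has as basis the 5040 multilinear normal DD-monomials, where a normal DD-monomial is a variable $x$, or $x\prec v$, or $x\succ v$, or $(x\succ u_1)\succ u_2$ with $x$ a variable and $v,u_1,u_2$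 normal DD-monomials. The choice of order within these bases does not affect the claim. *)

(* Defs.v *)
From HB Require Import structures.
From mathcomp Require Import all_boot all_order all_fingroup all_algebra.
From mathcomp Require Import finmap monalg.

Set Implicit Arguments.
Unset Strict Implicit.
Unset Printing Implicit Defensive.

Import GRing.Theory.
Local Open Scope ring_scope.

HB.mixin Record Lmodule_isDendriform (F : fieldType) V
    of GRing.Lmodule F V := {
  dprec : V -> V -> V;
  dsucc : V -> V -> V;
  dprec_bilinear : bilinear_for *:%R *:%R dprec;
  dsucc_bilinear : bilinear_for *:%R *:%R dsucc;
  dprec_dsucc : forall x y z,
    dprec (dsucc x y) z = dsucc x (dprec y z);
  dprec_dprec : forall x y z,
    dprec (dprec x y) z = dprec x (dprec y z) + dprec x (dsucc y z);
  dsucc_dsucc : forall x y z,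
    dsucc x (dsucc y z) = dsucc (dsucc x y) z + dsucc (dprec x y) z }.

#[short(type="dendriformType")]
HB.structure Definition Dendriform (F : fieldType) :=
  {V of GRing.Lmodule F V & Lmodule_isDendriform F V}.

Notation "x ≺ y" := (dprec x y) (at level 40, no associativity) : ring_scope.
Notation "x ≻ y" := (dsucc x y) (at level 40, no associativity) : ring_scope.

Definition dendriform_morphism (F : fieldType) (D A : dendriformType F)
    (h : D -> A) : Prop :=
  [/\ linear h, {morph h : u v / u ≺ v} & {morph h : u v / u ≻ v}].

(* D is a free dendriform dialgebra on the family x, by the universal property. *)
Definition free_dendriform (F : fieldType) (n : nat) (D : dendriformType F)
    (x : 'I_n -> D) : Prop :=
  forall (A : dendriformType F) (f : 'I_n -> A),
    exists h : D -> A,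
      [/\ dendriform_morphism h, forall i, h (x i) = f i
        & forall h' : D -> A, dendriform_morphism h' ->
            (forall i, h' (x i) = f i) -> h' =1 h].

Definition pre_jordan (F : fieldType) (D : dendriformType F) (x y : D) : D :=
  x ≻ y + y ≺ x.

Inductive ddmon (n : nat) :=
  | DDvar of 'I_n
  | DDprec of ddmon n & ddmon n
  | DDsucc of ddmon n & ddmon n.

Inductive ttmon (n : nat) :=
  | TTvar of 'I_n
  | TT1 of ttmon n & ttmon n & ttmon n
  | TT2 of ttmon n & ttmon n & ttmon n.

(* Equality is structural and the choice operators are opaque: with instances
   transported from GenTree.tree, conversion tests on {malg F[ttmon n]} unfold
   its encoding and do not terminate in practice. *)
Section MonomialChoice.
Variable n : nat.

Fixpoint ddmon_encode (m : ddmon n) : GenTree.tree 'I_n :=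
  match m with
  | DDvar i => GenTree.Leaf i
  | DDprec u v => GenTree.Node 1 [:: ddmon_encode u; ddmon_encode v]
  | DDsucc u v => GenTree.Node 2 [:: ddmon_encode u; ddmon_encode v]
  end.

Fixpoint ddmon_decode (t : GenTree.tree 'I_n) : option (ddmon n) :=
  match t with
  | GenTree.Leaf i => Some (DDvar i)
  | GenTree.Node k [:: t1; t2] =>
      match ddmon_decode t1, ddmon_decode t2 with
      | Some u, Some v => Some (if k == 1%N then DDprec u v else DDsucc u v)
      | _, _ => None
      end
  | _ => None
  end.

Lemma ddmon_encodeK : pcancel ddmon_encode ddmon_decode.
Proof. by elim=> //= u -> v ->. Qed.

Fixpoint ddmon_eqb (u v : ddmon n) : bool :=
  match u, v with
  | DDvar i, DDvar j => i == j
  | DDprec u1 u2, DDprec v1 v2 => ddmon_eqb u1 v1 && ddmon_eqb u2 v2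
  | DDsucc u1 u2, DDsucc v1 v2 => ddmon_eqb u1 v1 && ddmon_eqb u2 v2
  | _, _ => false
  end.

Lemma ddmon_eqP : Equality.axiom ddmon_eqb.
Proof.
move=> u v; apply: (iffP idP) => [|<-]; last first.
  by elim: u => [i|u1 IH1 u2 IH2|u1 IH1 u2 IH2] /=; rewrite ?eqxx // IH1 IH2.
elim: u v => [i|u1 IH1 u2 IH2|u1 IH1 u2 IH2] [j|v1 v2|v1 v2] //=.
- by move=> /eqP->.
- by move=> /andP[/IH1-> /IH2->].
- by move=> /andP[/IH1-> /IH2->].
Qed.

HB.instance Definition _ := hasDecEq.Build (ddmon n) ddmon_eqP.

Fact ddmon_hasChoice : hasChoice (ddmon n).
Proof. exact: Choice.class (pcan_type ddmon_encodeK). Qed.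

HB.instance Definition _ := ddmon_hasChoice.

Fixpoint ttmon_encode (m : ttmon n) : GenTree.tree 'I_n :=
  match m with
  | TTvar i => GenTree.Leaf i
  | TT1 u v w =>
      GenTree.Node 1 [:: ttmon_encode u; ttmon_encode v; ttmon_encode w]
  | TT2 u v w =>
      GenTree.Node 2 [:: ttmon_encode u; ttmon_encode v; ttmon_encode w]
  end.

Fixpoint ttmon_decode (t : GenTree.tree 'I_n) : option (ttmon n) :=
  match t with
  | GenTree.Leaf i => Some (TTvar i)
  | GenTree.Node k [:: t1; t2; t3] =>
      match ttmon_decode t1, ttmon_decode t2, ttmon_decode t3 with
      | Some u, Some v, Some w =>
          Some (if k == 1%N then TT1 u v w else TT2 u v w)
      | _, _, _ => None
      end
  | _ => None
  end.

Lemma ttmon_encodeK : pcancel ttmon_encode ttmon_decode.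
Proof. by elim=> //= u -> v -> w ->. Qed.

Fixpoint ttmon_eqb (u v : ttmon n) : bool :=
  match u, v with
  | TTvar i, TTvar j => i == j
  | TT1 u1 u2 u3, TT1 v1 v2 v3 =>
      [&& ttmon_eqb u1 v1, ttmon_eqb u2 v2 & ttmon_eqb u3 v3]
  | TT2 u1 u2 u3, TT2 v1 v2 v3 =>
      [&& ttmon_eqb u1 v1, ttmon_eqb u2 v2 & ttmon_eqb u3 v3]
  | _, _ => false
  end.

Lemma ttmon_eqP : Equality.axiom ttmon_eqb.
Proof.
move=> u v; apply: (iffP idP) => [|<-]; last first.
  by elim: u => [i|u1 IH1 u2 IH2 u3 IH3|u1 IH1 u2 IH2 u3 IH3] /=; rewrite ?eqxx // IH1 IH2 IH3.
elim: u v => [i|u1 IH1 u2 IH2 u3 IH3|u1 IH1 u2 IH2 u3 IH3] [j|v1 v2 v3|v1 v2 v3] //=.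
- by move=> /eqP->.
- by move=> /and3P[/IH1-> /IH2-> /IH3->].
- by move=> /and3P[/IH1-> /IH2-> /IH3->].
Qed.

HB.instance Definition _ := hasDecEq.Build (ttmon n) ttmon_eqP.

Fact ttmon_hasChoice : hasChoice (ttmon n).
Proof. exact: Choice.class (pcan_type ttmon_encodeK). Qed.

HB.instance Definition _ := ttmon_hasChoice.

End MonomialChoice.

Fixpoint ddmon_vars (n : nat) (m : ddmon n) : seq 'I_n :=
  match m with
  | DDvar i => [:: i]
  | DDprec u v | DDsucc u v => ddmon_vars u ++ ddmon_vars v
  end.

Definition ddmon_multilinear (n : nat) (m : ddmon n) : bool :=
  perm_eq (ddmon_vars m) (enum 'I_n).

Fixpoint ddmon_normal (n : nat) (m : ddmon n) : bool :=
  match m with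
  | DDvar _ => true
  | DDprec (DDvar _) v => ddmon_normal v
  | DDsucc (DDvar _) v => ddmon_normal v
  | DDsucc (DDsucc (DDvar _) u1) u2 => ddmon_normal u1 && ddmon_normal u2
  | _ => false
  end.

Fixpoint ddmon_eval (F : fieldType) (n : nat) (D : dendriformType F)
    (x : 'I_n -> D) (m : ddmon n) : D :=
  match m with
  | DDvar i => x i
  | DDprec u v => ddmon_eval x u ≺ ddmon_eval x v
  | DDsucc u v => ddmon_eval x u ≻ ddmon_eval x v
  end.

Fixpoint ttmon_vars (n : nat) (m : ttmon n) : seq 'I_n :=
  match m with
  | TTvar i => [:: i]
  | TT1 u v w | TT2 u v w => ttmon_vars u ++ ttmon_vars v ++ ttmon_vars w
  end.

Definition ttmon_multilinear (n : nat) (m : ttmon n) : bool :=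
  perm_eq (ttmon_vars m) (enum 'I_n).

Fixpoint ttmon_act (n : nat) (s : 'S_n) (m : ttmon n) : ttmon n :=
  match m with
  | TTvar i => TTvar (s i)
  | TT1 u v w => TT1 (ttmon_act s u) (ttmon_act s v) (ttmon_act s w)
  | TT2 u v w => TT2 (ttmon_act s u) (ttmon_act s v) (ttmon_act s w)
  end.

Fixpoint ttmon_expand (F : fieldType) (n : nat) (D : dendriformType F)
    (x : 'I_n -> D) (m : ttmon n) : D :=
  match m with
  | TTvar i => x i
  | TT1 u v w =>
      pre_jordan (pre_jordan (ttmon_expand x u) (ttmon_expand x v))
                 (ttmon_expand x w)
  | TT2 u v w =>
      pre_jordan (ttmon_expand x u)
                 (pre_jordan (ttmon_expand x v) (ttmon_expand x w))
  end.

(* The free algebra on two trilinear operations with no relations is the space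
   {malg F[ttmon n]} of formal linear combinations of monomials; lin_ext
   extends a function on monomials linearly. *)
Definition lin_ext (F : fieldType) (K : choiceType) (V : lmodType F)
    (f : K -> V) (t : {malg F[K]}) : V :=
  \sum_(m <- msupp t) t@_m *: f m.

(* Membership in TT_n, the multilinear subspace of degree n. *)
Definition TT (F : fieldType) (n : nat) (t : {malg F[ttmon n]}) : Prop :=
  forall m, m \in msupp t -> ttmon_multilinear m.

Definition TT_act (F : fieldType) (n : nat) (s : 'S_n) :
    {malg F[ttmon n]} -> {malg F[ttmon n]} :=
  lin_ext (fun m => << ttmon_act s m >>).

Definition expansion (F : fieldType) (n : nat) (D : dendriformType F)
    (x : 'I_n -> D) : {malg F[ttmon n]} -> D :=
  lin_ext (ttmon_expand x).

Definition expansion_ker (F : fieldType) (n : nat) (D : dendriformType F)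
    (x : 'I_n -> D) (t : {malg F[ttmon n]}) : Prop :=
  TT t /\ expansion x t = 0.

Definition Sn_submodule (F : fieldType) (n : nat)
    (U : {malg F[ttmon n]} -> Prop) : Prop :=
  [/\ U 0, forall (c : F) u v, U u -> U v -> U (c *: u + v)
    & forall (s : 'S_n) u, U u -> U (TT_act s u)].

(* The smallest S_n-submodule containing G. *)
Definition Sn_generated (F : fieldType) (n : nat)
    (G : {malg F[ttmon n]} -> Prop) (t : {malg F[ttmon n]}) : Prop :=
  forall U, Sn_submodule U -> (forall g, G g -> U g) -> U t.

Section PJTS.
Variable F : fieldType.

Let a : ttmon 5 := TTvar (inord 0).
Let b : ttmon 5 := TTvar (inord 1).
Let c : ttmon 5 := TTvar (inord 2).
Let d : ttmon 5 := TTvar (inord 3).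
Let e : ttmon 5 := TTvar (inord 4).

Definition PJTS1 : {malg F[ttmon 5]} :=
    <<TT1 (TT1 a b c) d e>> + <<TT1 (TT1 b a c) d e>>
  + <<TT1 (TT2 c a b) d e>> + <<TT1 (TT2 c b a) d e>>
  - <<TT1 a (TT1 b c d) e>> - <<TT1 a (TT1 c b d) e>>
  - <<TT1 b (TT1 a c d) e>> - <<TT1 b (TT1 c a d) e>>
  - <<TT1 c (TT1 a b d) e>> - <<TT1 c (TT1 b a d) e>>
  + <<TT1 a (TT2 c b d) e>> + <<TT1 b (TT2 c a d) e>>.

Definition PJTS2 : {malg F[ttmon 5]} :=
    <<TT2 (TT1 b d a) c e>> + <<TT2 (TT1 b d c) a e>>
  + <<TT2 (TT2 a b d) c e>> + <<TT2 (TT2 c b d) a e>>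
  - <<TT2 a (TT1 b d c) e>> - <<TT2 c (TT1 b d a) e>>
  - <<TT2 a (TT2 c b d) e>> - <<TT2 c (TT2 a b d) e>>
  + <<TT1 a c (TT1 b d e)>> - <<TT1 b d (TT1 a c e)>>
  - <<TT1 b d (TT1 c a e)>> + <<TT1 c a (TT1 b d e)>>.

Definition PJTS3 : {malg F[ttmon 5]} :=
    <<TT1 (TT1 b c d) a e>> + <<TT1 (TT2 d b c) a e>>
  + <<TT1 a (TT1 b c d) e>> - <<TT2 a (TT1 b c d) e>>
  - <<TT2 d (TT1 b c a) e>> + <<TT1 a (TT2 d b c) e>>
  - <<TT2 a (TT2 d b c) e>> - <<TT2 d (TT2 a b c) e>>
  - <<TT1 b c (TT1 a d e)>> - <<TT1 b c (TT1 d a e)>>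
  + <<TT2 d a (TT1 b c e)>> + <<TT1 b c (TT2 a d e)>>.

Definition PJTS4 : {malg F[ttmon 5]} :=
    <<TT2 a (TT1 b c d) e>> + <<TT2 a (TT1 c b d) e>>
  + <<TT2 a (TT2 d b c) e>> + <<TT2 a (TT2 d c b) e>>
  - <<TT2 a b (TT1 c d e)>> - <<TT2 a b (TT1 d c e)>>
  - <<TT2 a c (TT1 b d e)>> - <<TT2 a c (TT1 d b e)>>
  - <<TT2 a d (TT1 b c e)>> - <<TT2 a d (TT1 c b e)>>
  + <<TT2 a b (TT2 d c e)>> + <<TT2 a c (TT2 d b e)>>.

Definition PJTS5 : {malg F[ttmon 5]} :=
    <<TT2 (TT1 a c b) d e>> + <<TT2 (TT1 a c d) b e>>
  + <<TT2 (TT1 c a b) d e>> + <<TT2 (TT1 c a d) b e>>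
  + <<TT2 (TT1 c d b) a e>> + <<TT2 (TT1 d a b) c e>>
  + <<TT2 (TT1 d a c) b e>> + <<TT2 (TT1 d b a) c e>>
  + <<TT2 (TT1 d b c) a e>> + <<TT2 (TT1 d c b) a e>>
  + <<TT2 (TT2 a d b) c e>> + <<TT2 (TT2 b a c) d e>>
  + <<TT2 (TT2 b c a) d e>> + <<TT2 (TT2 b c d) a e>>
  + <<TT2 (TT2 b d a) c e>> + <<TT2 (TT2 b d c) a e>>
  + <<TT2 (TT2 c d a) b e>> + <<TT2 (TT2 c d b) a e>>
  + <<TT2 (TT2 d a c) b e>> + <<TT2 (TT2 d c a) b e>>
  - <<TT1 a (TT1 b c d) e>> - <<TT1 a (TT1 b d c) e>>
  - <<TT1 a (TT1 c b d) e>> - <<TT1 a (TT1 c d b) e>>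
  - <<TT1 a (TT1 d b c) e>> - <<TT1 a (TT1 d c b) e>>
  - <<TT1 b (TT1 a c d) e>> - <<TT1 b (TT1 a d c) e>>
  - <<TT1 b (TT1 c a d) e>> - <<TT1 b (TT1 c d a) e>>
  - <<TT1 b (TT1 d a c) e>> - <<TT1 b (TT1 d c a) e>>
  - <<TT1 c (TT1 a b d) e>> - <<TT1 c (TT1 a d b) e>>
  - <<TT1 c (TT1 b a d) e>> - <<TT1 c (TT1 b d a) e>>
  - <<TT1 c (TT1 d a b) e>> - <<TT1 c (TT1 d b a) e>>
  - <<TT1 d (TT1 a b c) e>> - <<TT1 d (TT1 a c b) e>>
  - <<TT1 d (TT1 b a c) e>> - <<TT1 d (TT1 b c a) e>>
  - <<TT1 d (TT1 c a b) e>> - <<TT1 d (TT1 c b a) e>>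
  - <<TT2 a (TT1 d b c) e>> + <<TT2 b (TT1 a d c) e>>
  + <<TT2 c (TT1 a d b) e>> - <<TT2 c (TT1 d b a) e>>
  - <<TT2 a (TT2 c d b) e>> + <<TT2 b (TT2 c a d) e>>
  - <<TT2 c (TT2 a d b) e>> + <<TT2 c (TT2 b a d) e>>
  + <<TT1 a b (TT1 c d e)>> + <<TT1 a b (TT1 d c e)>>
  + <<TT1 a c (TT1 d b e)>> + <<TT1 a d (TT1 b c e)>>
  + <<TT1 a d (TT1 c b e)>> + <<TT1 b a (TT1 c d e)>>
  + <<TT1 b a (TT1 d c e)>> + <<TT1 b c (TT1 d a e)>>
  + <<TT1 b d (TT1 a c e)>> + <<TT1 b d (TT1 c a e)>>
  + <<TT1 c a (TT1 d b e)>> + <<TT1 c b (TT1 d a e)>>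
  - <<TT2 b a (TT1 c d e)>> - <<TT2 b a (TT1 d c e)>>
  - <<TT2 b c (TT1 a d e)>> - <<TT2 b c (TT1 d a e)>>
  - <<TT2 b d (TT1 a c e)>> - <<TT2 b d (TT1 c a e)>>
  - <<TT2 c a (TT2 d b e)>> - <<TT2 d a (TT2 c b e)>>.

Definition PJTS (k : 'I_5) : {malg F[ttmon 5]} :=
  nth 0 [:: PJTS1; PJTS2; PJTS3; PJTS4; PJTS5] k.

End PJTS.

(* Main.v *)
(* Normal DD-monomials form a basis of the free dendriform dialgebra: on their
   formal combinations a product is defined by recursion on the left factor, and
   the axioms follow by induction on it. This reduces everything to finite
   computations, which equivariance further reduces to the twelve types of
   monomials of TT_5.

   Let E be the expansion map and M the S_5-module generated by the PJTS_k. There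
   is an equivariant map N from DD_5 to TT_5 with m - N (E m) in M for one
   monomial m of each type, hence for all. As E vanishes on M, it follows that M
   is the kernel of E and that id - N E is a projection onto it; its dimension is
   the trace of this projection, 120 times a sum of twelve coefficients.

   For each k, a linear form on TT_5 vanishes on all translates of the four other
   generators but not on PJTS_k. *)

(* The 5040 by 1440 matrix is never formed and nothing is eliminated: the content is an integer
   certificate. For each type, 288 m is the sum of the image of E m under a rescaled N and of an
   explicit combination of translates of the generators. All checks run over the integers, on lists
   whose letters are natural numbers, and are then carried to every field and every assignment of
   letters. N is far from unique, since it matters only on the image of E and modulo M; this freedom
   allows a sparse table. Characteristic zero enters in three places: 288 is inverted, a trace in F
   is read as a natural number, and the non-zero integer value of a linear form has to stay
   non-zero. The dialgebra D is given only by its universal property, so it is compared with the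
   model on normal forms through a morphism into that model. *)
Require Import Defs.
From HB Require Import structures.
From mathcomp Require Import all_boot all_order all_fingroup all_algebra.
From mathcomp Require Import finmap monalg zify ring.

Set Implicit Arguments.
Unset Strict Implicit.
Unset Printing Implicit Defensive.

Import GRing.Theory.
Local Open Scope ring_scope.

(** * Linear extension *)

Section LinearExtension.
Variables (F : fieldType) (K : choiceType) (V : lmodType F).
Implicit Types (f : K -> V) (t : {malg F[K]}).

(** Padding the support with zero terms brings several combinations to a common index set, which is
    what additivity needs. *)
Lemma lin_extEw f t (d : {fset K}) :
  {subset msupp t <= d} -> lin_ext f t = \sum_(m <- d) t@_m *: f m.
Proof.
move=> td; apply: big_fset_incl; first exact/fsubsetP.
by move=> m _ /mcoeff_outdom ->; rewrite scale0r.
Qed.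

Lemma lin_ext_is_linear f : linear (lin_ext f).
Proof.
move=> c t s; pose d := (msupp t `|` msupp s)%fset.
have subd g : {subset msupp g <= d} -> lin_ext f g = \sum_(m <- d) g@_m *: f m.
  exact: lin_extEw.
rewrite !subd.
- rewrite scaler_sumr -big_split /=; apply: eq_bigr => m _.
  by rewrite mcoeffD mcoeffZ scalerDl scalerA.
- by move=> m ms; rewrite in_fsetU ms orbT.
- by move=> m mt; rewrite in_fsetU mt.
- move=> m /(fsubsetP (msuppD_le _ _)); rewrite !in_fsetU => /orP[|-> //].
    by move=> /(fsubsetP (msuppZ_le _ _)) ->.
  by rewrite orbT.
Qed.

HB.instance Definition _ f :=
  GRing.isLinear.Build F {malg F[K]} V *:%R (lin_ext f) (lin_ext_is_linear f).

Lemma lin_extU f k : lin_ext f << k >> = f k.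
Proof.
rewrite (lin_extEw f (d := [fset k]%fset)); last by move=> m /(fsubsetP msuppU_le).
by rewrite big_seq_fset1 mcoeffUU scale1r.
Qed.

Lemma malg_lin_ind (Q : {malg F[K]} -> Prop) : Q 0 ->
  (forall c k t, Q t -> Q (c *: << k >> + t)) -> forall t, Q t.
Proof.
move=> Q0 QD t; rewrite [t]monalgE.
elim: {1}(enum_fset _) => [|k r IH]; first by rewrite big_nil.
rewrite big_cons; suff -> : << t@_k *g k >> = t@_k *: << k >> by exact: QD.
by apply/malgP => m; rewrite mcoeffZ !mcoeffU mulrnAr mulr1.
Qed.

Lemma lin_ext_unique (f g : {malg F[K]} -> V) : linear f -> linear g ->
  (forall k, f << k >> = g << k >>) -> f =1 g.
Proof.
move=> fl gl fg; elim/malg_lin_ind => [|c k t IH]; last by rewrite fl gl fg IH.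
have f0 (h : {malg F[K]} -> V) : linear h -> h 0 = 0.
  move=> hl; have := hl (-1) (0 : {malg F[K]}) 0.
  by rewrite scaler0 addr0 scaleN1r addNr.
by rewrite !f0.
Qed.

End LinearExtension.

Section BilinearExtension.
Variables (F : fieldType) (K K' : choiceType) (V : lmodType F).
Implicit Types (f : K -> K' -> V).

Definition bil_ext f (t : {malg F[K]}) (s : {malg F[K']}) : V :=
  lin_ext (fun u => lin_ext (f u) s) t.

Lemma bil_extPl f c t1 t2 s :
  bil_ext f (c *: t1 + t2) s = c *: bil_ext f t1 s + bil_ext f t2 s.
Proof. exact: linearP. Qed.

Lemma bil_extPr f t c s1 s2 :
  bil_ext f t (c *: s1 + s2) = c *: bil_ext f t s1 + bil_ext f t s2.
Proof.
have E s : bil_ext f t s = \sum_(u <- msupp t) t@_u *: lin_ext (f u) s by [].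
rewrite !E scaler_sumr -big_split.
apply: eq_bigr => u _ /=.
by rewrite linearP scalerDr !scalerA mulrC.
Qed.

Lemma bil_extU f u s : bil_ext f << u >> s = lin_ext (f u) s.
Proof. exact: lin_extU. Qed.

Lemma bil_extUU f u w : bil_ext f << u >> << w >> = f u w.
Proof. by rewrite bil_extU lin_extU. Qed.

End BilinearExtension.

(** * Formal combinations as lists *)

Section Combinations.
Variable K : Type.
Implicit Types l : seq (int * K).

Definition lc_map K' (f : K -> K') l := [seq (p.1, f p.2) | p <- l].
Definition lc_scale (c : int) l : seq (int * K) := [seq (c * p.1, p.2) | p <- l].
Definition lc_bind K' (f : K -> seq (int * K')) l :=
  flatten [seq [seq (p.1 * q.1, q.2) | q <- f p.2] | p <- l].

Variables (F : fieldType) (V : lmodType F).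
Implicit Type f : K -> V.

(** One integer calculation with lists is transported by this evaluation to every field and every
    family of vectors. *)
Definition lc_eval f l : V := \sum_(p <- l) p.1%:~R *: f p.2.

Lemma lc_eval_nil f : lc_eval f [::] = 0.
Proof. exact: big_nil. Qed.

Lemma lc_eval_cons f p l : lc_eval f (p :: l) = p.1%:~R *: f p.2 + lc_eval f l.
Proof. exact: big_cons. Qed.

Lemma lc_eval1 f k : lc_eval f [:: (1, k)] = f k.
Proof. by rewrite lc_eval_cons lc_eval_nil addr0 scale1r. Qed.

Lemma lc_eval_cat f l1 l2 : lc_eval f (l1 ++ l2) = lc_eval f l1 + lc_eval f l2.
Proof. exact: big_cat. Qed.

Lemma lc_eval_scale f c l : lc_eval f (lc_scale c l) = c%:~R *: lc_eval f l.
Proof.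
rewrite /lc_eval big_map scaler_sumr; apply: eq_bigr => p _.
by rewrite intrM scalerA.
Qed.

Lemma eq_lc_eval f g l : f =1 g -> lc_eval f l = lc_eval g l.
Proof. by move=> fg; apply: eq_bigr => p _; rewrite fg. Qed.

End Combinations.

Lemma lc_eval_linear K (F : fieldType) (V W : lmodType F) (h : {linear V -> W})
    (f : K -> V) l :
  h (lc_eval f l) = lc_eval (h \o f) l.
Proof. by rewrite linear_sum; apply: eq_bigr => p _; rewrite linearZ. Qed.

Section CombinationsComp.
Variables (K K' : Type) (F : fieldType) (V : lmodType F).

Lemma lc_eval_map (g : K -> K') (f : K' -> V) l :
  lc_eval f (lc_map g l) = lc_eval (f \o g) l.
Proof. exact: big_map. Qed.

Lemma lc_eval_bind (g : K -> seq (int * K')) (f : K' -> V) l :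
  lc_eval f (lc_bind g l) = lc_eval (fun k => lc_eval f (g k)) l.
Proof.
elim: l => [|p l IH]; first by rewrite !lc_eval_nil.
rewrite lc_eval_cons -IH /lc_bind /= lc_eval_cat; congr (_ + _).
rewrite {1}/lc_eval big_map scaler_sumr; apply: eq_bigr => q _.
by rewrite intrM scalerA.
Qed.

End CombinationsComp.

Section CombinationsCollect.
Variable K : eqType.

Fixpoint lc_add (p : int * K) (l : seq (int * K)) :=
  if l is q :: l' then
    if p.2 == q.2 then (p.1 + q.1, q.2) :: l' else q :: lc_add p l'
  else [:: p].

Definition lc_collect (l : seq (int * K)) := foldr lc_add [::] l.

Definition lc_null l := all (fun p => p.1 == 0) (lc_collect l).

Variables (F : fieldType) (V : lmodType F).

Lemma lc_eval_collect (f : K -> V) l : lc_eval f (lc_collect l) = lc_eval f l.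
Proof.
elim: l => //= p l IH; rewrite [RHS]lc_eval_cons -{}IH.
elim: (lc_collect l) => [|q m IHm] /=; first exact: lc_eval_cons.
case: eqP => [pq|_]; last by rewrite !lc_eval_cons IHm addrCA.
by rewrite !lc_eval_cons /= pq intrD scalerDl addrA.
Qed.

(** All cancellation happens between integer coefficients of equal keys, so a single computation
    gives the relation for every [f] and every field. *)
Lemma lc_nullP (f : K -> V) l : lc_null l -> lc_eval f l = 0.
Proof.
move=> /allP l0; rewrite -lc_eval_collect /lc_eval big_seq big1 // => p.
by move=> /l0/eqP ->; rewrite scale0r.
Qed.

End CombinationsCollect.

(** * The free dendriform dialgebra *)

(** Normal DD-monomials as a type of their own: [NQ a v w] stands for [(a ≻ v) ≻ w]. The letters are
    arbitrary, so that tables can use natural numbers and the model can use variables. *)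
Inductive nf (T : Type) : Type :=
  | NV of T
  | NP of T & nf T
  | NS of T & nf T
  | NQ of T & nf T & nf T.

Section NormalForms.

Fixpoint nf_map T T' (f : T -> T') (u : nf T) : nf T' :=
  match u with
  | NV a => NV (f a)
  | NP a v => NP (f a) (nf_map f v)
  | NS a v => NS (f a) (nf_map f v)
  | NQ a v w => NQ (f a) (nf_map f v) (nf_map f w)
  end.

Fixpoint nf_eqb (T : eqType) (u v : nf T) : bool :=
  match u, v with
  | NV a, NV b => a == b
  | NP a u', NP b v' | NS a u', NS b v' => (a == b) && nf_eqb u' v'
  | NQ a u1 u2, NQ b v1 v2 => [&& a == b, nf_eqb u1 v1 & nf_eqb u2 v2]
  | _, _ => false
  end.

Lemma nf_eqP (T : eqType) : Equality.axiom (@nf_eqb T).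
Proof.
move=> u v; apply: (iffP idP) => [|<-]; last first.
  by elim: u => [a|a u IH|a u IH|a u1 IH1 u2 IH2] /=; rewrite ?eqxx ?IH ?IH1 ?IH2.
elim: u v => [a|a u IH|a u IH|a u1 IH1 u2 IH2] [b|b v|b v|b v1 v2] //=.
- by move=> /eqP->.
- by move=> /andP[/eqP-> /IH->].
- by move=> /andP[/eqP-> /IH->].
- by move=> /and3P[/eqP-> /IH1-> /IH2->].
Qed.

HB.instance Definition _ (T : eqType) := hasDecEq.Build (nf T) (@nf_eqP T).

Fixpoint nf_encode T (u : nf T) : GenTree.tree T :=
  match u with
  | NV a => GenTree.Leaf a
  | NP a v => GenTree.Node 1 [:: GenTree.Leaf a; nf_encode v]
  | NS a v => GenTree.Node 2 [:: GenTree.Leaf a; nf_encode v]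
  | NQ a v w => GenTree.Node 3 [:: GenTree.Leaf a; nf_encode v; nf_encode w]
  end.

Fixpoint nf_decode T (t : GenTree.tree T) : option (nf T) :=
  match t with
  | GenTree.Leaf a => Some (NV a)
  | GenTree.Node k [:: GenTree.Leaf a; t1] =>
      omap (if k == 1%N then NP a else NS a) (nf_decode t1)
  | GenTree.Node k [:: GenTree.Leaf a; t1; t2] =>
      if nf_decode t1 is Some v then omap (NQ a v) (nf_decode t2) else None
  | _ => None
  end.

Lemma nf_encodeK T : pcancel (@nf_encode T) (@nf_decode T).
Proof. by elim=> //= [a v ->|a v ->|a v -> w ->]. Qed.

Fact nf_hasChoice (T : choiceType) : hasChoice (nf T).
Proof. exact: Choice.class (pcan_type (@nf_encodeK T)). Qed.

HB.instance Definition _ (T : choiceType) := nf_hasChoice T.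

(* [b] selects the product: [≺] if true, [≻] if false. The clauses for [NP] and
   [NQ] solve the third dendriform axiom for the product that is not normal. *)
Fixpoint nf_mul T (b : bool) (u w : nf T) : seq (int * nf T) :=
  match u with
  | NV a => [:: (1, if b then NP a w else NS a w)]
  | NP a v =>
      if b then lc_map (NP a) (nf_mul true v w ++ nf_mul false v w)
      else lc_map (NS a) (nf_mul false v w) ++ [:: (-1, NQ a v w)]
  | NS a v =>
      if b then lc_map (NS a) (nf_mul true v w) else [:: (1, NQ a v w)]
  | NQ a u1 u2 =>
      if b then lc_map (NQ a u1) (nf_mul true u2 w)
      else lc_map (NQ a u1) (nf_mul false u2 w)
           ++ lc_scale (-1) (lc_map (fun v => NQ a v w) (nf_mul true u1 u2))
  end.

End NormalForms.

(** * The dendriform axioms along left operators *)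

Section DendriformStep.
Variables (V : zmodType) (prec succ : V -> V -> V).
Implicit Types t y z : V.

(** Only the leftmost argument is fixed: each axiom is linear in it, which reduces it to a normal
    form, while [y] and [z] stay arbitrary vectors. *)
Definition dend_at t := forall y z,
  [/\ prec (succ t y) z = succ t (prec y z),
      prec (prec t y) z = prec t (prec y z) + prec t (succ y z)
    & succ t (succ y z) = succ (succ t y) z + succ (prec t y) z].

Hypothesis precDl : forall t y z, prec (t + y) z = prec t z + prec y z.
Hypothesis precBl : forall t y z, prec (t - y) z = prec t z - prec y z.
Hypothesis succDl : forall t y z, succ (t + y) z = succ t z + succ y z.
Hypothesis succBl : forall t y z, succ (t - y) z = succ t z - succ y z.

(* [P], [S] and [Q] stand for the operators [x ≺ -], [x ≻ -] and
   [(x ≻ -) ≻ -] given by a generator [x]. *)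
Variables (P S : V -> V) (Q : V -> V -> V).
Hypothesis PD : forall t y, P (t + y) = P t + P y.
Hypothesis SD : forall t y, S (t + y) = S t + S y.
Hypothesis QDl : forall t y z, Q (t + y) z = Q t z + Q y z.
Hypothesis QDr : forall t y z, Q t (y + z) = Q t y + Q t z.
Hypothesis prec_P : forall t y, prec (P t) y = P (prec t y) + P (succ t y).
Hypothesis succ_P : forall t y, succ (P t) y = S (succ t y) - Q t y.
Hypothesis prec_S : forall t y, prec (S t) y = S (prec t y).
Hypothesis succ_S : forall t y, succ (S t) y = Q t y.
Hypothesis prec_Q : forall t y z, prec (Q t y) z = Q t (prec y z).
Hypothesis succ_Q : forall t y z, succ (Q t y) z = Q t (succ y z) - Q (prec t y) z.

Lemma dend_at_gen x : prec x =1 P -> succ x =1 S -> dend_at x.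
Proof.
move=> xP xS y z; rewrite !xP !xS; split.
- by rewrite prec_S.
- by rewrite prec_P.
- by rewrite succ_S succ_P addrC subrK.
Qed.

Lemma dend_at_P t : dend_at t -> dend_at (P t).
Proof.
move=> IH y z; have [A1 A2 A3] := IH y z; split.
- by rewrite !succ_P precBl prec_S prec_Q A1.
- rewrite !prec_P precDl !prec_P -!PD A1 A2 A3; congr (P _).
  rewrite -!addrA; congr (_ + _); rewrite [RHS]addrCA; congr (_ + _).
  by rewrite addrCA; congr (_ + _); rewrite addrC.
- rewrite !succ_P !prec_P succBl succDl !succ_P succ_S succ_Q A3 SD.
  set a := S (succ (succ _ _) _); set b := S _; set q := Q t _.
  set r := Q (succ _ _) _; set w := Q (prec _ _) _.
  rewrite opprB [b - w + _]addrACA -opprD [r + _]addrA [r + w]addrC.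
  rewrite [w + r - q + _]addrAC.
  by rewrite [w + r + _]addrC subrK [b + a]addrC.
Qed.

Lemma dend_at_S t : dend_at t -> dend_at (S t).
Proof.
move=> IH y z; have [A1 A2 A3] := IH y z; split.
- by rewrite !succ_S prec_Q.
- by rewrite !prec_S A2 SD.
- by rewrite !succ_S prec_S succ_S succ_Q subrK.
Qed.

(** The correction term [Q (prec t s) y] of [succ_Q] leads in the third axiom to
    [prec (prec t s) y], which the second axiom at [t] expands. Hence the hypothesis is used at both
    [t] and [s]. *)
Lemma dend_at_Q t s : dend_at t -> dend_at s -> dend_at (Q t s).
Proof.
move=> IH1 IH2 y z.
have [A1 A2 A3] := IH2 y z; have [_ B2 _] := IH1 s y; split.
- by rewrite !succ_Q precBl !prec_Q A1.
- by rewrite !prec_Q A2 QDr.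
- rewrite !succ_Q !prec_Q succBl !succ_Q A3 B2 QDl QDr.
  set a := Q t _; set b := Q t _; set q := Q _ (succ y z).
  set r := Q (prec t (succ _ _)) _; set w := Q _ z.
  rewrite opprB [w + r]addrC -[r + w - q]addrA [a - r + _]addrA subrK.
  by rewrite -[RHS]addrA [w - q + _]addrC [b - w + _]addrA subrK addrA.
Qed.

End DendriformStep.

Definition free_dend (F : fieldType) (T : choiceType) := {malg F[nf T]}.
HB.instance Definition _ F T := GRing.Lmodule.on (free_dend F T).

Definition nf_mk (F : fieldType) (T : choiceType) (u : nf T) : free_dend F T :=
  << u >>.
Arguments nf_mk F {T} u.

HB.lock Definition fmul (F : fieldType) (T : choiceType) (b : bool) :
    free_dend F T -> free_dend F T -> free_dend F T :=
  bil_ext (fun u w => lc_eval (@nf_mk F T) (nf_mul b u w)).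

Section FreeDendriform.
Variables (F : fieldType) (T : choiceType).
Notation free_dend := (free_dend F T).
Notation nf_mk := (@nf_mk F T).
Notation fmul := (@fmul F T).

Let opP a : free_dend -> free_dend := lin_ext (fun v => nf_mk (NP a v)).
Let opS a : free_dend -> free_dend := lin_ext (fun v => nf_mk (NS a v)).
Let opQ a : free_dend -> free_dend -> free_dend :=
  bil_ext (fun v w => nf_mk (NQ a v w)).

Lemma fmulPl b c t1 t2 s : fmul b (c *: t1 + t2) s = c *: fmul b t1 s + fmul b t2 s.
Proof. by rewrite fmul.unlock bil_extPl. Qed.

Lemma fmulPr b c t s1 s2 : fmul b t (c *: s1 + s2) = c *: fmul b t s1 + fmul b t s2.
Proof. by rewrite fmul.unlock bil_extPr. Qed.

Let opPP a c t1 t2 : opP a (c *: t1 + t2) = c *: opP a t1 + opP a t2.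
Proof. exact: linearP. Qed.

Let opSP a c t1 t2 : opS a (c *: t1 + t2) = c *: opS a t1 + opS a t2.
Proof. exact: linearP. Qed.

Let opQPl a c t1 t2 s : opQ a (c *: t1 + t2) s = c *: opQ a t1 s + opQ a t2 s.
Proof. exact: bil_extPl. Qed.

Let opQPr a c t s1 s2 : opQ a t (c *: s1 + s2) = c *: opQ a t s1 + opQ a t s2.
Proof. exact: bil_extPr. Qed.

Let linP := (fmulPl, fmulPr, opPP, opSP, opQPl, opQPr).

Lemma fmulUU b u w : fmul b << u >> << w >> = lc_eval nf_mk (nf_mul b u w).
Proof. by rewrite fmul.unlock bil_extUU. Qed.

Let fmul_V b a s : fmul b (nf_mk (NV a)) s = if b then opP a s else opS a s.
Proof.
by case: b; rewrite fmul.unlock bil_extU; apply: eq_bigr => u _; rewrite lc_eval1.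
Qed.

Let lc_eval_P a l : lc_eval nf_mk (lc_map (NP a) l) = opP a (lc_eval nf_mk l).
Proof.
by rewrite lc_eval_map /opP lc_eval_linear; apply: eq_lc_eval => u; rewrite /= lin_extU.
Qed.

Let lc_eval_S a l : lc_eval nf_mk (lc_map (NS a) l) = opS a (lc_eval nf_mk l).
Proof.
by rewrite lc_eval_map /opS lc_eval_linear; apply: eq_lc_eval => u; rewrite /= lin_extU.
Qed.

Let lc_eval_Q a u l :
  lc_eval nf_mk (lc_map (NQ a u) l) = opQ a << u >> (lc_eval nf_mk l).
Proof.
rewrite lc_eval_map /opQ bil_extU lc_eval_linear.
by apply: eq_lc_eval => v; rewrite /= lin_extU.
Qed.

Let lc_eval_Ql a w l :
  lc_eval nf_mk (lc_map (fun v => NQ a v w) l) = opQ a (lc_eval nf_mk l) << w >>.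
Proof.
rewrite lc_eval_map /opQ /bil_ext lc_eval_linear.
by apply: eq_lc_eval => v; rewrite /= !lin_extU.
Qed.

Let by_basis (f g : free_dend -> free_dend) :
  (forall c t s, f (c *: t + s) = c *: f t + f s) ->
  (forall c t s, g (c *: t + s) = c *: g t + g s) ->
  (forall u, f << u >> = g << u >>) -> forall t, f t = g t.
Proof. exact: lin_ext_unique. Qed.

Let by_basis2 (f g : free_dend -> free_dend -> free_dend) :
  (forall s c t1 t2, f (c *: t1 + t2) s = c *: f t1 s + f t2 s) ->
  (forall t c s1 s2, f t (c *: s1 + s2) = c *: f t s1 + f t s2) ->
  (forall s c t1 t2, g (c *: t1 + t2) s = c *: g t1 s + g t2 s) ->
  (forall t c s1 s2, g t (c *: s1 + s2) = c *: g t s1 + g t s2) ->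
  (forall u w, f << u >> << w >> = g << u >> << w >>) ->
  forall t s, f t s = g t s.
Proof.
move=> fl fr gl gr fg t s; apply: (by_basis (f := f^~ s) (g := g^~ s)) => // u.
exact: by_basis.
Qed.

Let combine (c : F) (x y z w : free_dend) :
  c *: x + y + (c *: z + w) = c *: (x + z) + (y + w).
Proof. by rewrite scalerDr addrACA. Qed.

Let combineB (c : F) (x y z w : free_dend) :
  c *: x + y - (c *: z + w) = c *: (x - z) + (y - w).
Proof. by rewrite opprD -scalerN combine. Qed.

Let prec_P a t s : fmul true (opP a t) s = opP a (fmul true t s) + opP a (fmul false t s).
Proof.
move: t s; apply: by_basis2 => [s c t u|t c s u|s c t u|t c s u|u w].
1-4: by rewrite !linP ?combine.
by rewrite {1}/opP lin_extU !fmulUU lc_eval_P lc_eval_cat /opP linearD.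
Qed.

Let succ_P a t s : fmul false (opP a t) s = opS a (fmul false t s) - opQ a t s.
Proof.
move: t s; apply: by_basis2 => [s c t u|t c s u|s c t u|t c s u|u w].
1-4: by rewrite !linP ?combineB.
rewrite {1}/opP lin_extU !fmulUU lc_eval_cat lc_eval_S; congr (_ + _).
by rewrite lc_eval_cons lc_eval_nil addr0 scaleN1r /opQ bil_extUU.
Qed.

Let prec_S a t s : fmul true (opS a t) s = opS a (fmul true t s).
Proof.
move: t s; apply: by_basis2 => [s c t u|t c s u|s c t u|t c s u|u w].
1-4: by rewrite !linP.
by rewrite {1}/opS lin_extU !fmulUU lc_eval_S.
Qed.

Let succ_S a t s : fmul false (opS a t) s = opQ a t s.
Proof.
move: t s; apply: by_basis2 => [s c t u|t c s u|s c t u|t c s u|u w].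
1-4: by rewrite !linP.
by rewrite {1}/opS lin_extU !fmulUU lc_eval1 /opQ bil_extUU.
Qed.

Let prec_Q a u t s : fmul true (opQ a << u >> t) s = opQ a << u >> (fmul true t s).
Proof.
move: t s; apply: by_basis2 => [s c t v|t c s v|s c t v|t c s v|v w].
1-4: by rewrite !linP.
by rewrite {1}/opQ bil_extUU !fmulUU lc_eval_Q.
Qed.

Let succ_Q a u t s : fmul false (opQ a << u >> t) s =
  opQ a << u >> (fmul false t s) - opQ a (fmul true << u >> t) s.
Proof.
move: t s; apply: by_basis2 => [s c t v|t c s v|s c t v|t c s v|v w].
1-4: by rewrite !linP ?combineB.
rewrite {1}/opQ bil_extUU !fmulUU lc_eval_cat lc_eval_Q lc_eval_scale.
by rewrite lc_eval_Ql scaleN1r.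
Qed.

Let prec_QQ a t1 t2 s : fmul true (opQ a t1 t2) s = opQ a t1 (fmul true t2 s).
Proof.
move: t1; apply: (by_basis (f := fun t => _) (g := fun t => _)) => [c t u|c t u|u].
- by rewrite !linP.
- by rewrite !linP.
- exact: prec_Q.
Qed.

Let succ_QQ a t1 t2 s : fmul false (opQ a t1 t2) s =
  opQ a t1 (fmul false t2 s) - opQ a (fmul true t1 t2) s.
Proof.
move: t1; apply: (by_basis (f := fun t => _) (g := fun t => _)) => [c t u|c t u|u].
- by rewrite !linP.
- by rewrite !linP combineB.
- exact: succ_Q.
Qed.

Let fmulDl b t y z : fmul b (t + y) z = fmul b t z + fmul b y z.
Proof. by have := fmulPl b 1 t y z; rewrite !scale1r. Qed.

Let fmulBl b t y z : fmul b (t - y) z = fmul b t z - fmul b y z.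
Proof.
by have := fmulPl b (-1) y t z; rewrite !scaleN1r addrC [X in _ = X]addrC.
Qed.

Let opPD a t y : opP a (t + y) = opP a t + opP a y.
Proof. by have := opPP a 1 t y; rewrite !scale1r. Qed.

Let opSD a t y : opS a (t + y) = opS a t + opS a y.
Proof. by have := opSP a 1 t y; rewrite !scale1r. Qed.

Let opQDl a t y z : opQ a (t + y) z = opQ a t z + opQ a y z.
Proof. by have := opQPl a 1 t y z; rewrite !scale1r. Qed.

Let opQDr a t y z : opQ a t (y + z) = opQ a t y + opQ a t z.
Proof. by have := opQPr a 1 t y z; rewrite !scale1r. Qed.

Let dend_at_basis u : dend_at (fmul true) (fmul false) << u >>.
Proof.
elim: u => [a|a v IH|a v IH|a u1 IH1 u2 IH2].
- exact: (dend_at_gen (prec_P a) (succ_P a) (prec_S a) (succ_S a)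
                      (fmul_V true a) (fmul_V false a)).
- have -> : << NP a v >> = opP a << v >> by rewrite /opP lin_extU.
  exact: (dend_at_P (fmulDl true) (fmulBl true) (fmulDl false) (fmulBl false)
            (opPD a) (opSD a) (prec_P a) (succ_P a) (prec_S a) (succ_S a)
            (prec_QQ a) (succ_QQ a) IH).
- have -> : << NS a v >> = opS a << v >> by rewrite /opS lin_extU.
  exact: (dend_at_S (opSD a) (prec_S a) (succ_S a) (prec_QQ a) (succ_QQ a) IH).
- have -> : << NQ a u1 u2 >> = opQ a << u1 >> << u2 >> by rewrite /opQ bil_extUU.
  exact: (dend_at_Q (fmulBl true) (fmulBl false) (opQDl a) (opQDr a)
            (prec_QQ a) (succ_QQ a) IH1 IH2).
Qed.

Lemma fmul_dend t : dend_at (fmul true) (fmul false) t.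
Proof.
move=> y z; split; move: t;
  apply: (by_basis (f := fun t => _) (g := fun t => _)) => [c t s|c t s|u].
1,4,7: by rewrite !fmulPl.
1,3,5: by rewrite !fmulPl ?combine.
all: by case: (dend_at_basis u y z).
Qed.

Lemma fmul_bilinear b : bilinear_for *:%R *:%R (fmul b).
Proof. by split=> [s c t1 t2|t c s1 s2]; rewrite (fmulPl, fmulPr). Qed.

HB.instance Definition _ := Lmodule_isDendriform.Build F free_dend
  (fmul_bilinear true) (fmul_bilinear false)
  (fun x y z => let: And3 e _ _ := fmul_dend x y z in e)
  (fun x y z => let: And3 _ e _ := fmul_dend x y z in e)
  (fun x y z => let: And3 _ _ e := fmul_dend x y z in e).

End FreeDendriform.

(** * Evaluation of normal forms *)

Section DendriformTheory.
Variables (F : fieldType) (D : dendriformType F).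
Implicit Types (t s : D) (c : F).

Definition dmul (b : bool) t s : D := if b then t ≺ s else t ≻ s.

Lemma dmulPl b s c t1 t2 : dmul b (c *: t1 + t2) s = c *: dmul b t1 s + dmul b t2 s.
Proof. by case: b; [apply: dprec_bilinear.1|apply: dsucc_bilinear.1]. Qed.

Lemma dmulPr b t c s1 s2 : dmul b t (c *: s1 + s2) = c *: dmul b t s1 + dmul b t s2.
Proof. by case: b; [apply: dprec_bilinear.2|apply: dsucc_bilinear.2]. Qed.

Lemma dmul_is_linear b t : linear (dmul b t).
Proof. by move=> c s1 s2; apply: dmulPr. Qed.

HB.instance Definition _ b t :=
  GRing.isLinear.Build F D D *:%R (dmul b t) (dmul_is_linear b t).

Definition dmulr b s t : D := dmul b t s.

Lemma dmulr_is_linear b s : linear (dmulr b s).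
Proof. by move=> c t1 t2; rewrite /dmulr dmulPl. Qed.

HB.instance Definition _ b s :=
  GRing.isLinear.Build F D D *:%R (dmulr b s) (dmulr_is_linear b s).

Variables (T : Type) (x : T -> D).

Fixpoint nf_eval (u : nf T) : D :=
  match u with
  | NV a => x a
  | NP a v => x a ≺ nf_eval v
  | NS a v => x a ≻ nf_eval v
  | NQ a v w => (x a ≻ nf_eval v) ≻ nf_eval w
  end.

(** Each clause of [nf_mul] is an instance of the axioms, so products computed on normal forms are
    correct in every dendriform dialgebra. *)
Lemma nf_mul_eval b u w :
  lc_eval nf_eval (nf_mul b u w) = dmul b (nf_eval u) (nf_eval w).
Proof.
have lcP a l : lc_eval nf_eval (lc_map (NP a) l) = dmul true (x a) (lc_eval nf_eval l).
  by rewrite lc_eval_map lc_eval_linear.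
have lcS a l : lc_eval nf_eval (lc_map (NS a) l) = dmul false (x a) (lc_eval nf_eval l).
  by rewrite lc_eval_map lc_eval_linear.
have lcQ a u' l : lc_eval nf_eval (lc_map (NQ a u') l) =
    dmul false (dmul false (x a) (nf_eval u')) (lc_eval nf_eval l).
  by rewrite lc_eval_map lc_eval_linear.
have lcQl a w' l : lc_eval nf_eval (lc_map (fun v => NQ a v w') l) =
    dmul false (dmul false (x a) (lc_eval nf_eval l)) (nf_eval w').
  by rewrite lc_eval_map -!/(dmulr _ (nf_eval w') _) !lc_eval_linear.
elim: u b w => [a|a v IH|a v IH|a u1 IH1 u2 IH2] [] w /=.
- by rewrite lc_eval1.
- by rewrite lc_eval1.
- by rewrite lcP lc_eval_cat !IH linearD /dmul dprec_dprec.
- rewrite lc_eval_cat lcS IH lc_eval_cons lc_eval_nil addr0 scaleN1r.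
  by rewrite /dmul /= dsucc_dsucc addrC addKr.
- by rewrite lcS IH /dmul dprec_dsucc.
- by rewrite lc_eval1.
- by rewrite lcQ IH2 /dmul dprec_dsucc.
- rewrite lc_eval_cat lcQ lc_eval_scale lcQl IH1 IH2 scaleN1r.
  (* The first axiom turns [x ≻ (u1 ≺ u2)] back into [(x ≻ u1) ≺ u2]; then the third axiom applies
     with [x ≻ u1] as its leftmost argument. *)
  by rewrite /dmul -dprec_dsucc dsucc_dsucc addrK.
Qed.

Definition lc_mul b (l m : seq (int * nf T)) :=
  lc_bind (fun u => lc_bind (nf_mul b u) m) l.

Lemma lc_mul_eval b l m :
  lc_eval nf_eval (lc_mul b l m) = dmul b (lc_eval nf_eval l) (lc_eval nf_eval m).
Proof.
rewrite lc_eval_bind -[dmul b _ _]/(dmulr b _ _) lc_eval_linear.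
apply: eq_lc_eval => u /=.
rewrite lc_eval_bind /dmulr lc_eval_linear; apply: eq_lc_eval => w.
exact: nf_mul_eval.
Qed.

Definition lc_pj l m := lc_mul false l m ++ lc_mul true m l.

Lemma lc_pj_eval l m :
  lc_eval nf_eval (lc_pj l m) = pre_jordan (lc_eval nf_eval l) (lc_eval nf_eval m).
Proof. by rewrite lc_eval_cat !lc_mul_eval. Qed.

End DendriformTheory.

Lemma nf_eval_map (F : fieldType) (D : dendriformType F) T T' (f : T -> T')
    (x : T' -> D) u : nf_eval x (nf_map f u) = nf_eval (x \o f) u.
Proof. by elim: u => //= [a v ->|a v ->|a v -> w ->]. Qed.

(** A normal form is built by products that [nf_mul] leaves as a single term. So distinct normal
    monomials take distinct basis vectors as values, and their independence rests on this. *)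
Lemma free_dend_eval (F : fieldType) (T : choiceType) (u : nf T) :
  nf_eval (fun a : T => nf_mk F (NV a) : free_dend F T) u = nf_mk F u.
Proof.
have mulE b v w : dmul b (nf_mk F v) (nf_mk F w) = lc_eval (nf_mk F) (nf_mul b v w).
  by case: b; rewrite -fmulUU.
elim: u => //= [a v ->|a v ->|a v -> w ->].
- by rewrite -[LHS]/(dmul true _ _) mulE lc_eval1.
- by rewrite -[LHS]/(dmul false _ _) mulE lc_eval1.
- rewrite -[LHS]/(dmul false (dmul false _ _) _) [dmul false _ (nf_mk F v)]mulE.
  by rewrite lc_eval1 mulE lc_eval1.
Qed.

(** * Morphisms and the comparison with a free dialgebra *)

Section Morphism.
Variables (F : fieldType) (D : dendriformType F).

Lemma nf_eval_morph (D' : dendriformType F) (h : D -> D') T (x : T -> D) u :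
  dendriform_morphism h -> h (nf_eval x u) = nf_eval (h \o x) u.
Proof.
by case=> _ hp hs; elim: u => //= [a v <-|a v <-|a v <- w <-]; rewrite ?hs ?hp.
Qed.

Lemma ttmon_expand_morph (D' : dendriformType F) (h : D -> D') n
    (x : 'I_n -> D) m :
  dendriform_morphism h -> h (ttmon_expand x m) = ttmon_expand (h \o x) m.
Proof.
case=> hl hp hs; have hpj t s : h (pre_jordan t s) = pre_jordan (h t) (h s).
  by rewrite /pre_jordan -hp -hs -[_ ≻ _]scale1r hl !scale1r.
by elim: m => //= u <- v <- w <-; rewrite !hpj.
Qed.

Variables (T : choiceType) (x : T -> D).

Definition nf_spec : free_dend F T -> D := lin_ext (nf_eval x).

HB.instance Definition _ := GRing.isLinear.Build F (free_dend F T) D *:%R nf_spec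
  (lin_ext_is_linear (nf_eval x)).

Lemma nf_specU u : nf_spec (nf_mk F u) = nf_eval x u.
Proof. exact: lin_extU. Qed.

Lemma nf_specP c t s : nf_spec (c *: t + s) = c *: nf_spec t + nf_spec s.
Proof. exact: linearP. Qed.

Lemma nf_spec_morphism : dendriform_morphism nf_spec.
Proof.
have mulE b t s : nf_spec (dmul b t s) = dmul b (nf_spec t) (nf_spec s).
  move: t; refine (lin_ext_unique
    (f := fun t : free_dend F T => nf_spec (dmul b t s))
    (g := fun t : free_dend F T => dmul b (nf_spec t) (nf_spec s)) _ _ _)
    => [c t u|c t u|u].
  - by rewrite dmulPl nf_specP.
  - by rewrite nf_specP dmulPl.
  move: s; refine (lin_ext_unique
    (f := fun s : free_dend F T => nf_spec (dmul b (nf_mk F u) s))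
    (g := fun s : free_dend F T => dmul b (nf_spec (nf_mk F u)) (nf_spec s)) _ _ _)
    => [c t s|c t s|w].
  - by rewrite dmulPr nf_specP.
  - by rewrite nf_specP dmulPr.
  rewrite -/(nf_mk F w).
  have -> : dmul b (nf_mk F u) (nf_mk F w) = lc_eval (nf_mk F) (nf_mul b u w).
    by case: b; rewrite -fmulUU.
  rewrite lc_eval_linear !nf_specU -nf_mul_eval.
  by apply: eq_lc_eval => v; rewrite /= nf_specU.
split=> [|t s|t s]; first exact: lin_ext_is_linear.
- exact: (mulE true).
- exact: (mulE false).
Qed.

End Morphism.

Lemma dendriform_morphism_comp (F : fieldType) (D1 D2 D3 : dendriformType F)
    (g : D2 -> D3) (h : D1 -> D2) :
  dendriform_morphism g -> dendriform_morphism h -> dendriform_morphism (g \o h).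
Proof.
move=> [gl gp gs] [hl hp hs]; split=> [c t s|t s|t s] /=.
- by rewrite hl gl.
- by rewrite hp gp.
- by rewrite hs gs.
Qed.

(** Freeness of [D] gives the morphism to the model. The composite back to [D] and the identity
    agree on the generators, so the uniqueness clause, applied to [x] itself, identifies them. *)
Lemma free_dendriform_normal (F : fieldType) n (D : dendriformType F)
    (x : 'I_n -> D) : free_dendriform x ->
  exists h : D -> free_dend F 'I_n,
    [/\ dendriform_morphism h, forall i, h (x i) = nf_mk F (NV i)
      & cancel h (nf_spec x)].
Proof.
move=> Dfree; have [h [hm hx _]] := Dfree _ (fun i => nf_mk F (NV i) : free_dend F _).
exists h; split=> // t; have [k [_ _ kuniq]] := Dfree _ x.
have gm := dendriform_morphism_comp (nf_spec_morphism x) hm.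
have gE : nf_spec x (h t) = k t.
  by apply: (kuniq _ gm) => i; rewrite /= hx nf_specU.
have idE : id t = k t by apply: kuniq.
by rewrite gE -idE.
Qed.

(** * Monomials of degree five *)

(** A monomial of degree five as a type and a word. Its letters are natural numbers so that the
    tables can be evaluated; [mon] replaces them by variables. *)
Definition tm : Type := nat * (nat * nat * nat * nat * nat).

(* [c] times the monomial of type [tau] (see [compose2]) in the letters
   [i1], ..., [i5]. *)
Definition term (c : int) (tau i1 i2 i3 i4 i5 : nat) : int * tm :=
  (c, (tau, (i1, i2, i3, i4, i5))).
Arguments term c%_Z (tau i1 i2 i3 i4 i5)%_N.

Definition word_fun (w : nat * nat * nat * nat * nat) : nat -> nat :=
  let: (i1, i2, i3, i4, i5) := w in nth 0%N [:: i1; i2; i3; i4; i5].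

Definition word_map T T' (f : T -> T') (w : T * T * T * T * T) :
    T' * T' * T' * T' * T' :=
  let: (i1, i2, i3, i4, i5) := w in (f i1, f i2, f i3, f i4, f i5).

Definition tm_map (f : nat -> nat) (k : tm) : tm := (k.1, word_map f k.2).

Definition tm_id (tau : nat) : tm := (tau, (0, 1, 2, 3, 4)%N).

(* Types [tau > 11] are junk: they repeat type 11. *)
Definition compose2 X (t1 t2 : X -> X -> X -> X) (tau : nat)
    (w : X * X * X * X * X) : X :=
  let: (a, b, c, d, e) := w in
  match tau with
  | 0 => t1 (t1 a b c) d e
  | 1 => t1 (t2 a b c) d e
  | 2 => t2 (t1 a b c) d e
  | 3 => t2 (t2 a b c) d e
  | 4 => t1 a (t1 b c d) e
  | 5 => t1 a (t2 b c d) e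
  | 6 => t2 a (t1 b c d) e
  | 7 => t2 a (t2 b c d) e
  | 8 => t1 a b (t1 c d e)
  | 9 => t1 a b (t2 c d e)
  | 10 => t2 a b (t1 c d e)
  | _ => t2 a b (t2 c d e)
  end.

Definition tm_expand (k : tm) : seq (int * nf nat) :=
  compose2 (fun l1 l2 l3 => lc_pj (lc_pj l1 l2) l3)
           (fun l1 l2 l3 => lc_pj l1 (lc_pj l2 l3))
           k.1 (word_map (fun i => [:: (1, NV i)]) k.2).

(** The prefix code of the shape: each constructor has a fixed arity, so the code together with
    [nf_letters] determines the normal form. *)
Fixpoint nf_code T (u : nf T) : seq nat :=
  match u with
  | NV _ => [:: 0%N]
  | NP _ v => 1%N :: nf_code v
  | NS _ v => 2%N :: nf_code v
  | NQ _ v w => 3%N :: nf_code v ++ nf_code w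
  end.

Fixpoint nf_letters T (u : nf T) : seq T :=
  match u with
  | NV a => [:: a]
  | NP a v | NS a v => a :: nf_letters v
  | NQ a v w => a :: nf_letters v ++ nf_letters w
  end.

Definition nf_head T (u : nf T) : T :=
  match u with NV a | NP a _ | NS a _ | NQ a _ _ => a end.

Definition nf_letter T (u : nf T) (i : nat) : T := nth (nf_head u) (nf_letters u) i.

(** * The certificate: generators, inverse and remainders *)

Definition pjts (k : nat) : seq (int * tm) :=
  match k with
  | 0 =>
      [:: term 1 0 0 1 2 3 4; term 1 0 1 0 2 3 4; term 1 1 2 0 1 3 4;
          term 1 1 2 1 0 3 4; term (-1) 4 0 1 2 3 4; term (-1) 4 0 2 1 3 4;
          term (-1) 4 1 0 2 3 4; term (-1) 4 1 2 0 3 4; term (-1) 4 2 0 1 3 4;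
          term (-1) 4 2 1 0 3 4; term 1 5 0 2 1 3 4; term 1 5 1 2 0 3 4]
  | 1 =>
      [:: term 1 2 1 3 0 2 4; term 1 2 1 3 2 0 4; term 1 3 0 1 3 2 4;
          term 1 3 2 1 3 0 4; term (-1) 6 0 1 3 2 4; term (-1) 6 2 1 3 0 4;
          term (-1) 7 0 2 1 3 4; term (-1) 7 2 0 1 3 4; term 1 8 0 2 1 3 4;
          term (-1) 8 1 3 0 2 4; term (-1) 8 1 3 2 0 4; term 1 8 2 0 1 3 4]
  | 2 =>
      [:: term 1 0 1 2 3 0 4; term 1 1 3 1 2 0 4; term 1 4 0 1 2 3 4;
          term (-1) 6 0 1 2 3 4; term (-1) 6 3 1 2 0 4; term 1 5 0 3 1 2 4;
          term (-1) 7 0 3 1 2 4; term (-1) 7 3 0 1 2 4; term (-1) 8 1 2 0 3 4;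
          term (-1) 8 1 2 3 0 4; term 1 10 3 0 1 2 4; term 1 9 1 2 0 3 4]
  | 3 =>
      [:: term 1 6 0 1 2 3 4; term 1 6 0 2 1 3 4; term 1 7 0 3 1 2 4;
          term 1 7 0 3 2 1 4; term (-1) 10 0 1 2 3 4; term (-1) 10 0 1 3 2 4;
          term (-1) 10 0 2 1 3 4; term (-1) 10 0 2 3 1 4;
          term (-1) 10 0 3 1 2 4; term (-1) 10 0 3 2 1 4; term 1 11 0 1 3 2 4;
          term 1 11 0 2 3 1 4]
  | _ =>
      [:: term 1 2 0 2 1 3 4; term 1 2 0 2 3 1 4; term 1 2 2 0 1 3 4;
          term 1 2 2 0 3 1 4; term 1 2 2 3 1 0 4; term 1 2 3 0 1 2 4;
          term 1 2 3 0 2 1 4; term 1 2 3 1 0 2 4; term 1 2 3 1 2 0 4;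
          term 1 2 3 2 1 0 4; term 1 3 0 3 1 2 4; term 1 3 1 0 2 3 4;
          term 1 3 1 2 0 3 4; term 1 3 1 2 3 0 4; term 1 3 1 3 0 2 4;
          term 1 3 1 3 2 0 4; term 1 3 2 3 0 1 4; term 1 3 2 3 1 0 4;
          term 1 3 3 0 2 1 4; term 1 3 3 2 0 1 4; term (-1) 4 0 1 2 3 4;
          term (-1) 4 0 1 3 2 4; term (-1) 4 0 2 1 3 4; term (-1) 4 0 2 3 1 4;
          term (-1) 4 0 3 1 2 4; term (-1) 4 0 3 2 1 4; term (-1) 4 1 0 2 3 4;
          term (-1) 4 1 0 3 2 4; term (-1) 4 1 2 0 3 4; term (-1) 4 1 2 3 0 4;
          term (-1) 4 1 3 0 2 4; term (-1) 4 1 3 2 0 4; term (-1) 4 2 0 1 3 4;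
          term (-1) 4 2 0 3 1 4; term (-1) 4 2 1 0 3 4; term (-1) 4 2 1 3 0 4;
          term (-1) 4 2 3 0 1 4; term (-1) 4 2 3 1 0 4; term (-1) 4 3 0 1 2 4;
          term (-1) 4 3 0 2 1 4; term (-1) 4 3 1 0 2 4; term (-1) 4 3 1 2 0 4;
          term (-1) 4 3 2 0 1 4; term (-1) 4 3 2 1 0 4; term (-1) 6 0 3 1 2 4;
          term 1 6 1 0 3 2 4; term 1 6 2 0 3 1 4; term (-1) 6 2 3 1 0 4;
          term (-1) 7 0 2 3 1 4; term 1 7 1 2 0 3 4; term (-1) 7 2 0 3 1 4;
          term 1 7 2 1 0 3 4; term 1 8 0 1 2 3 4; term 1 8 0 1 3 2 4;
          term 1 8 0 2 3 1 4; term 1 8 0 3 1 2 4; term 1 8 0 3 2 1 4;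
          term 1 8 1 0 2 3 4; term 1 8 1 0 3 2 4; term 1 8 1 2 3 0 4;
          term 1 8 1 3 0 2 4; term 1 8 1 3 2 0 4; term 1 8 2 0 3 1 4;
          term 1 8 2 1 3 0 4; term (-1) 10 1 0 2 3 4; term (-1) 10 1 0 3 2 4;
          term (-1) 10 1 2 0 3 4; term (-1) 10 1 2 3 0 4;
          term (-1) 10 1 3 0 2 4; term (-1) 10 1 3 2 0 4;
          term (-1) 11 2 0 3 1 4; term (-1) 11 3 0 2 1 4]
  end.

(* An equivariant left inverse of [scale] times the expansion map, modulo the
   submodule generated by the [pjts]. A row [(c, l)] gives the image of the
   normal form with [nf_code] [c] whose letters are 0, ..., 4 in this order. The
   entries are a sparse solution of a linear system. *)
Definition inverse_table : seq (seq nat * seq (int * tm)) := [::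
  ([:: 1; 1; 1; 1; 0]%N,
   [:: term (-72) 0 3 4 2 1 0; term (-72) 1 2 3 4 1 0; term (-72) 5 3 2 4 1 0;
       term (-72) 5 4 2 3 1 0; term (-16) 6 3 4 2 1 0; term 18 8 3 1 4 2 0;
       term (-18) 8 4 2 3 1 0]);
  ([:: 1; 1; 1; 2; 0]%N,
   [:: term 72 0 3 4 2 1 0; term (-36) 2 3 2 1 4 0; term (-36) 3 4 3 1 2 0;
       term 36 6 4 3 2 1 0; term (-36) 7 4 2 3 1 0; term (-18) 8 4 1 3 2 0;
       term (-18) 8 4 2 3 1 0]);
  ([:: 1; 1; 3; 0; 0]%N,
   [:: term 36 2 2 4 1 3 0; term 20 6 2 3 4 1 0]);
  ([:: 1; 1; 2; 1; 0]%N,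
   [:: term (-36) 2 2 3 1 4 0; term (-72) 4 2 4 3 1 0; term 72 4 4 2 3 1 0;
       term 72 5 4 3 2 1 0; term 36 6 4 2 3 1 0; term (-36) 8 2 1 4 3 0;
       term 36 8 4 3 2 1 0]);
  ([:: 1; 1; 2; 2; 0]%N,
   [:: term 72 1 2 3 4 1 0; term 36 2 2 4 1 3 0; term 36 3 2 3 1 4 0;
       term 72 4 2 4 3 1 0; term 72 4 3 4 2 1 0; term 72 4 4 3 2 1 0;
       term (-20) 6 3 2 4 1 0; term 36 7 2 4 3 1 0; term (-18) 8 2 1 3 4 0;
       term 18 8 3 4 2 1 0]);
  ([:: 1; 3; 1; 0; 0]%N,
   [:: term 72 1 2 3 1 4 0; term 36 2 3 2 1 4 0; term 36 2 3 2 4 1 0;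
       term (-36) 4 2 1 3 4 0; term (-36) 4 2 3 1 4 0; term (-36) 4 3 2 1 4 0;
       term 72 5 3 2 1 4 0; term (-36) 6 4 3 1 2 0; term (-36) 6 4 3 2 1 0;
       term 36 8 1 4 3 2 0; term (-36) 8 3 2 1 4 0; term (-18) 8 3 2 4 1 0]);
  ([:: 1; 3; 2; 0; 0]%N,
   [:: term (-36) 2 1 3 4 2 0; term (-36) 6 4 2 3 1 0; term (-18) 8 2 4 1 3 0;
       term (-36) 8 3 1 2 4 0]);
  ([:: 1; 3; 0; 1; 0]%N,
   [:: term (-72) 5 2 1 4 3 0; term 16 6 1 4 2 3 0; term 18 8 2 1 4 3 0;
       term 18 8 4 3 1 2 0]);
  ([:: 1; 2; 1; 1; 0]%N,
   [:: term 26 2 3 1 2 4 0; term 26 3 1 4 2 3 0; term 36 3 4 3 2 1 0;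
       term (-36) 4 4 3 1 2 0; term (-20) 6 4 3 1 2 0; term (-34) 7 1 4 3 2 0;
       term 16 7 4 1 3 2 0; term 18 8 3 1 4 2 0; term 18 8 4 3 1 2 0]);
  ([:: 1; 2; 1; 2; 0]%N,
   [:: term 10 2 1 3 2 4 0; term (-36) 3 1 3 2 4 0; term (-26) 3 3 4 2 1 0;
       term (-36) 4 4 3 1 2 0; term 72 5 4 1 3 2 0; term (-16) 6 4 1 3 2 0;
       term 14 7 1 3 4 2 0; term (-2) 7 1 4 3 2 0; term (-14) 7 3 1 4 2 0;
       term 20 7 4 1 3 2 0; term (-18) 8 3 2 4 1 0; term 18 8 4 1 3 2 0]);
  ([:: 1; 2; 3; 0; 0]%N,
   [:: term (-72) 5 1 2 3 4 0; term 18 8 2 4 1 3 0; term (-18) 8 2 4 3 1 0]);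
  ([:: 1; 2; 2; 1; 0]%N,
   [:: term (-36) 2 2 4 3 1 0; term (-36) 3 1 2 3 4 0; term 36 3 4 2 3 1 0;
       term (-72) 4 1 4 2 3 0; term 72 5 1 2 4 3 0; term 20 6 1 2 4 3 0;
       term 16 6 1 4 2 3 0; term (-36) 7 1 4 2 3 0; term 36 7 4 1 2 3 0;
       term (-18) 8 1 2 4 3 0; term (-18) 8 1 4 2 3 0; term (-18) 8 2 4 1 3 0;
       term 18 8 4 3 1 2 0]);
  ([:: 1; 2; 2; 2; 0]%N,
   [:: term (-10) 2 1 3 4 2 0; term 36 2 3 2 4 1 0; term (-10) 3 3 2 4 1 0;
       term 36 4 1 2 3 4 0; term 36 4 1 3 2 4 0; term 36 4 2 3 1 4 0;
       term (-72) 5 2 1 3 4 0; term (-36) 6 1 3 2 4 0; term 16 6 2 1 3 4 0;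
       term 20 7 1 3 2 4 0; term (-2) 7 3 1 2 4 0; term 36 8 1 3 2 4 0;
       term (-18) 8 2 1 3 4 0; term (-18) 8 2 4 1 3 0; term 36 8 3 4 2 1 0]);
  ([:: 3; 1; 0; 1; 0]%N,
   [:: term (-72) 1 0 2 1 4 3; term (-72) 1 1 2 0 4 3; term 24 4 0 1 2 4 3;
       term 24 4 1 0 2 4 3; term 48 4 1 2 0 4 3; term 72 4 2 0 1 4 3;
       term 48 4 2 1 0 4 3; term (-40) 6 4 2 0 1 3; term (-40) 6 4 2 1 0 3]);
  ([:: 3; 1; 0; 2; 0]%N,
   [:: term 72 1 0 2 1 3 4; term 72 1 1 2 0 3 4; term (-36) 2 2 0 1 3 4;
       term (-36) 2 2 1 0 3 4; term (-72) 4 0 2 1 3 4; term (-72) 4 1 2 0 3 4;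
       term (-72) 4 2 1 0 3 4; term 36 6 3 2 0 1 4; term 36 6 3 2 1 0 4;
       term 18 8 2 0 3 1 4; term 18 8 2 1 3 0 4]);
  ([:: 3; 2; 0; 1; 0]%N,
   [:: term 72 1 2 1 0 4 3; term 36 6 4 1 0 2 3]);
  ([:: 3; 2; 0; 2; 0]%N,
   [:: term 36 2 1 0 2 3 4; term (-36) 6 3 1 0 2 4]);
  ([:: 3; 0; 1; 1; 0]%N,
   [:: term 3 2 0 3 4 1 2; term (-4) 2 0 4 1 3 2; term 1 2 3 0 4 1 2;
       term (-34) 2 4 0 3 1 2; term (-9) 3 0 1 3 4 2; term 3 3 0 4 1 3 2;
       term (-29) 3 3 4 0 1 2; term 1 3 4 3 0 1 2; term (-72) 4 4 0 3 1 2;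
       term 72 5 1 0 4 3 2; term (-18) 6 0 4 1 3 2; term (-2) 6 4 0 3 1 2;
       term (-10) 7 0 3 4 1 2; term 6 7 0 4 3 1 2; term (-2) 7 3 0 1 4 2;
       term 16 7 3 0 4 1 2; term 2 7 4 0 1 3 2; term (-6) 8 1 0 4 3 2;
       term (-30) 8 4 3 1 0 2; term (-70) 10 1 0 4 3 2; term 2 10 3 4 1 0 2;
       term (-15) 11 0 1 3 4 2; term 2 11 0 1 4 3 2; term (-15) 11 0 3 4 1 2;
       term 4 11 0 4 3 1 2]);
  ([:: 3; 0; 1; 2; 0]%N,
   [:: term 2 6 3 0 4 1 2; term 6 8 3 4 0 1 2; term (-2) 10 4 3 1 0 2]);
  ([:: 3; 0; 2; 1; 0]%N,
   [:: term 72 0 1 0 2 4 3; term (-72) 1 2 0 1 4 3; term (-14) 2 1 0 2 4 3;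
       term 6 7 0 4 2 1 3; term 6 7 2 0 4 1 3; term 6 8 0 1 4 2 3;
       term 18 8 2 4 0 1 3; term 10 10 4 2 1 0 3]);
  ([:: 3; 0; 2; 2; 0]%N,
   [:: term 72 0 1 0 3 2 4; term (-72) 1 3 0 1 2 4; term 72 4 3 0 1 2 4]);
  ([:: 2; 1; 1; 1; 0]%N,
   [:: term (-6) 2 0 2 3 4 1; term 6 2 0 3 4 2 1; term (-4) 2 2 0 4 3 1;
       term 1 2 3 2 0 4 1; term (-12) 2 4 2 0 3 1; term 59 2 4 3 2 0 1;
       term 1 3 0 3 2 4 1; term (-12) 3 0 4 2 3 1; term 2 3 3 4 0 2 1;
       term (-67) 3 3 4 2 0 1; term 6 3 4 0 3 2 1; term (-4) 3 4 2 0 3 1;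
       term 14 3 4 2 3 0 1; term (-72) 4 0 4 3 2 1; term 24 4 2 0 3 4 1;
       term (-24) 4 2 3 4 0 1; term (-48) 4 2 4 3 0 1; term 24 4 3 0 2 4 1;
       term (-24) 4 3 4 2 0 1; term (-24) 4 4 3 2 0 1; term 72 5 0 3 4 2 1;
       term 72 5 3 2 4 0 1; term 72 5 4 2 3 0 1; term 26 6 0 4 3 2 1;
       term 8 6 2 0 4 3 1; term (-10) 6 3 0 2 4 1; term (-2) 6 4 2 0 3 1;
       term (-30) 6 4 3 2 0 1; term (-4) 7 0 3 4 2 1; term 2 7 0 4 3 2 1;
       term (-10) 7 3 4 0 2 1; term (-30) 7 4 0 3 2 1; term (-2) 7 4 3 0 2 1;
       term 12 8 0 2 4 3 1; term (-12) 8 0 3 4 2 1; term (-12) 8 3 0 4 2 1;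
       term (-6) 8 3 2 0 4 1; term (-24) 8 4 0 3 2 1; term 30 8 4 2 0 3 1;
       term 36 8 4 2 3 0 1; term (-10) 10 0 2 4 3 1; term 10 10 0 4 3 2 1;
       term (-28) 10 2 0 4 3 1; term 10 10 2 3 4 0 1; term (-4) 10 3 2 0 4 1;
       term 20 10 3 4 0 2 1; term 4 10 4 0 3 2 1; term (-2) 11 2 3 0 4 1;
       term (-4) 11 2 3 4 0 1; term (-8) 11 3 0 4 2 1; term (-4) 11 4 0 2 3 1]);
  ([:: 2; 1; 1; 2; 0]%N,
   [:: term (-2) 2 0 2 3 4 1; term 28 2 3 2 4 0 1; term 63 2 3 4 2 0 1;
       term (-17) 2 4 2 0 3 1; term (-8) 2 4 2 3 0 1; term (-17) 3 0 4 2 3 1;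
       term (-8) 3 3 4 2 0 1; term 37 3 4 3 2 0 1; term (-72) 4 0 3 4 2 1;
       term (-24) 4 3 2 4 0 1; term 30 6 0 3 4 2 1; term 32 6 3 4 2 0 1;
       term (-6) 6 4 0 3 2 1; term 4 7 0 4 3 2 1; term 32 7 3 0 4 2 1;
       term (-8) 7 4 3 0 2 1; term (-18) 8 0 3 4 2 1; term (-6) 8 0 4 3 2 1;
       term (-24) 8 3 0 4 2 1; term (-12) 8 3 2 0 4 1; term (-48) 10 2 0 3 4 1;
       term 10 10 2 3 0 4 1; term 2 11 3 2 4 0 1; term (-11) 11 4 0 2 3 1;
       term (-2) 11 4 2 0 3 1; term (-6) 11 4 2 3 0 1; term 11 11 4 3 2 0 1]);
  ([:: 2; 1; 3; 0; 0]%N,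
   [:: term (-6) 7 2 0 4 3 1; term (-6) 7 4 2 0 3 1; term (-6) 8 2 3 0 4 1]);
  ([:: 2; 1; 2; 1; 0]%N,
   [:: term 1 2 2 3 0 4 1; term 12 2 2 3 4 0 1; term (-21) 2 2 4 3 0 1;
       term (-51) 2 4 2 3 0 1; term 35 2 4 3 0 2 1; term 24 2 4 3 2 0 1;
       term 1 3 0 2 3 4 1; term 35 3 0 4 3 2 1; term 97 3 2 4 3 0 1;
       term (-6) 3 3 2 0 4 1; term (-8) 3 3 2 4 0 1; term 6 3 3 4 0 2 1;
       term 8 3 3 4 2 0 1; term 11 3 4 2 3 0 1; term 48 4 0 2 4 3 1;
       term 24 4 0 3 2 4 1; term (-24) 4 0 3 4 2 1; term 24 4 0 4 2 3 1;
       term (-24) 4 2 0 4 3 1; term 24 4 4 0 2 3 1; term (-72) 5 0 2 4 3 1;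
       term (-72) 5 2 3 4 0 1; term (-26) 6 0 2 4 3 1; term (-6) 6 0 4 2 3 1;
       term 4 6 0 4 3 2 1; term (-18) 6 2 4 3 0 1; term (-18) 6 4 2 3 0 1;
       term 24 7 0 2 4 3 1; term 12 7 0 4 2 3 1; term (-12) 7 2 0 4 3 1;
       term (-24) 7 4 0 2 3 1; term 42 8 0 2 4 3 1; term (-6) 8 0 4 2 3 1;
       term 60 8 2 0 4 3 1; term (-6) 8 2 3 0 4 1; term (-24) 8 4 0 2 3 1;
       term (-30) 8 4 3 0 2 1; term (-36) 8 4 3 2 0 1; term (-24) 10 2 0 4 3 1;
       term (-24) 10 3 2 4 0 1; term 24 10 3 4 2 0 1; term 24 10 4 0 2 3 1;
       term (-15) 11 0 2 3 4 1; term 15 11 0 4 3 2 1; term 2 11 2 0 4 3 1;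
       term (-2) 11 2 3 4 0 1; term 13 11 3 2 0 4 1; term (-13) 11 3 4 0 2 1;
       term (-2) 11 4 0 2 3 1; term 2 11 4 3 2 0 1]);
  ([:: 2; 1; 2; 2; 0]%N,
   [:: term 2 2 0 4 3 2 1; term 13 2 2 3 4 0 1; term (-7) 2 2 4 0 3 1;
       term 8 2 3 2 4 0 1; term 12 2 3 4 0 2 1; term (-7) 3 0 2 4 3 1;
       term 12 3 0 3 4 2 1; term 30 3 2 3 4 0 1; term (-33) 3 3 2 4 0 1;
       term (-24) 4 3 4 2 0 1; term (-24) 4 4 2 3 0 1; term (-72) 5 0 2 3 4 1;
       term 6 6 0 3 2 4 1; term 6 6 2 0 3 4 1; term (-4) 6 2 3 4 0 1;
       term (-32) 7 0 3 2 4 1; term (-4) 7 2 0 3 4 1; term 8 7 2 3 0 4 1;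
       term 18 8 0 2 3 4 1; term (-6) 8 0 3 2 4 1; term 12 8 2 0 3 4 1;
       term 6 8 2 4 0 3 1; term (-18) 8 3 4 0 2 1; term (-36) 8 3 4 2 0 1;
       term 48 10 4 0 3 2 1; term (-10) 10 4 3 0 2 1; term 11 11 2 0 4 3 1;
       term (-11) 11 2 3 4 0 1; term 2 11 2 4 0 3 1; term 6 11 2 4 3 0 1;
       term (-2) 11 3 4 2 0 1]);
  ([:: 2; 3; 1; 0; 0]%N,
   [:: term 72 1 1 3 2 0 4; term 36 2 3 1 2 0 4; term (-36) 4 1 2 3 0 4;
       term (-36) 4 1 3 2 0 4; term (-36) 4 3 1 2 0 4; term (-36) 6 1 3 2 0 4;
       term (-18) 8 3 1 0 2 4]);
  ([:: 2; 3; 2; 0; 0]%N,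
   [:: term (-72) 1 3 2 1 0 4; term (-36) 2 2 1 3 0 4; term 36 6 2 1 3 0 4]);
  ([:: 2; 3; 0; 1; 0]%N,
   [:: term (-18) 8 0 4 1 2 3; term 10 10 4 0 1 2 3]);
  ([:: 2; 3; 0; 2; 0]%N,
   [:: term (-72) 0 2 1 3 0 4; term 72 1 3 1 2 0 4]);
  ([:: 2; 2; 1; 1; 0]%N,
   [:: term (-2) 2 0 1 4 3 2; term 1 2 0 3 1 4 2; term (-2) 2 0 3 4 1 2;
       term (-5) 2 0 4 3 1 2; term 6 2 1 0 3 4 2; term 4 2 1 0 4 3 2;
       term (-3) 2 1 3 4 0 2; term 36 2 1 4 3 0 2; term 5 2 3 0 1 4 2;
       term (-18) 2 3 1 0 4 2; term (-5) 2 3 1 4 0 2; term 2 2 3 4 1 0 2;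
       term (-41) 2 4 0 3 1 2; term 28 2 4 1 3 0 2; term (-6) 2 4 3 0 1 2;
       term (-4) 2 4 3 1 0 2; term (-5) 3 0 4 1 3 2; term (-6) 3 0 4 3 1 2;
       term (-6) 3 1 0 4 3 2; term 2 3 1 3 4 0 2; term (-31) 3 1 4 0 3 2;
       term (-4) 3 1 4 3 0 2; term 6 3 3 1 0 4 2; term 41 3 3 1 4 0 2;
       term (-9) 3 3 4 0 1 2; term 29 3 3 4 1 0 2; term (-2) 3 4 0 1 3 2;
       term 4 3 4 1 0 3 2; term 2 3 4 1 3 0 2; term 5 3 4 3 1 0 2;
       term (-72) 4 0 3 1 4 2; term (-72) 4 1 3 0 4 2; term 72 4 3 0 4 1 2;
       term (-36) 4 3 4 1 0 2; term (-72) 5 0 1 4 3 2; term (-2) 6 0 1 3 4 2;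
       term (-22) 6 0 1 4 3 2; term (-12) 6 0 4 1 3 2; term 6 6 0 4 3 1 2;
       term 2 6 1 0 3 4 2; term 6 6 1 4 0 3 2; term 6 6 1 4 3 0 2;
       term (-6) 6 3 1 0 4 2; term 10 6 3 1 4 0 2; term 2 6 3 4 0 1 2;
       term 2 6 3 4 1 0 2; term (-6) 6 4 1 0 3 2; term (-6) 6 4 1 3 0 2;
       term (-2) 6 4 3 0 1 2; term 6 7 0 1 4 3 2; term (-20) 7 0 3 1 4 2;
       term (-12) 7 0 3 4 1 2; term 6 7 1 0 4 3 2; term 2 7 1 4 0 3 2;
       term 12 7 1 4 3 0 2; term 22 7 3 0 4 1 2; term 8 7 3 1 0 4 2;
       term (-6) 7 3 4 1 0 2; term (-22) 7 4 0 1 3 2; term (-4) 7 4 1 3 0 2;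
       term (-6) 7 4 3 1 0 2; term 18 8 0 4 1 3 2; term 6 8 0 4 3 1 2;
       term 6 8 1 0 4 3 2; term (-12) 8 1 3 0 4 2; term (-6) 8 1 3 4 0 2;
       term 6 8 1 4 0 3 2; term (-6) 8 3 1 0 4 2; term (-36) 8 3 1 4 0 2;
       term 6 8 3 4 1 0 2; term 6 8 4 0 1 3 2; term 30 8 4 0 3 1 2;
       term 12 8 4 1 3 0 2; term 36 8 4 3 0 1 2; term 48 8 4 3 1 0 2;
       term 70 10 0 1 4 3 2; term (-70) 10 1 0 4 3 2; term 2 10 3 1 0 4 2;
       term 2 10 3 1 4 0 2; term (-2) 10 4 0 1 3 2; term (-2) 10 4 0 3 1 2;
       term 70 10 4 3 1 0 2; term (-19) 11 0 1 3 4 2; term 2 11 0 1 4 3 2;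
       term 2 11 0 3 1 4 2; term 19 11 0 4 3 1 2; term (-17) 11 1 0 4 3 2;
       term 2 11 1 3 0 4 2; term 17 11 1 3 4 0 2; term (-4) 11 1 4 3 0 2;
       term (-15) 11 3 0 1 4 2; term (-2) 11 3 0 4 1 2; term (-2) 11 4 0 3 1 2;
       term 15 11 4 3 0 1 2]);
  ([:: 2; 2; 1; 2; 0]%N,
   [:: term (-3) 2 0 3 4 1 2; term 7 2 3 0 4 1 2; term 7 3 0 1 4 3 2;
       term (-33) 3 4 1 3 0 2; term (-36) 4 1 0 3 4 2; term 72 5 3 1 4 0 2;
       term 20 6 1 0 3 4 2; term 2 6 1 3 0 4 2; term 14 7 0 4 1 3 2;
       term 30 8 1 0 3 4 2; term (-2) 10 0 3 1 4 2; term (-2) 10 0 3 4 1 2;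
       term (-70) 10 1 0 3 4 2; term 2 10 3 0 1 4 2; term 2 10 3 0 4 1 2;
       term 4 11 0 1 4 3 2; term (-15) 11 0 3 4 1 2; term 15 11 1 0 3 4 2;
       term (-2) 11 3 0 1 4 2]);
  ([:: 2; 2; 2; 1; 0]%N,
   [:: term 4 2 0 4 2 1 3; term 8 2 1 0 2 4 3; term 23 2 1 0 4 2 3;
       term 1 2 1 2 0 4 3; term (-28) 2 2 0 1 4 3; term 6 2 4 0 1 2 3;
       term (-6) 2 4 1 2 0 3; term (-2) 3 1 2 4 0 3; term (-14) 3 2 0 1 4 3;
       term 4 3 2 0 4 1 3; term 41 3 2 1 0 4 3; term (-6) 3 2 4 1 0 3;
       term 23 3 4 1 0 2 3; term (-24) 4 0 1 2 4 3; term (-24) 4 0 4 1 2 3;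
       term (-24) 4 1 4 0 2 3; term (-8) 6 0 4 2 1 3; term 4 6 1 2 0 4 3;
       term 10 6 1 4 0 2 3; term 2 6 2 0 4 1 3; term (-2) 6 2 1 0 4 3;
       term (-4) 6 4 2 0 1 3; term 6 6 4 2 1 0 3; term 10 7 1 2 4 0 3;
       term 4 7 1 4 2 0 3; term 2 7 2 1 4 0 3; term (-2) 7 2 4 1 0 3;
       term 30 7 4 2 1 0 3; term 48 8 2 4 1 0 3; term (-12) 8 4 0 2 1 3;
       term 24 8 4 2 1 0 3; term (-10) 10 0 1 2 4 3; term 28 10 0 4 2 1 3;
       term 4 10 1 0 4 2 3; term (-20) 10 1 2 4 0 3; term (-4) 10 2 4 1 0 3;
       term 10 10 4 0 2 1 3; term (-10) 10 4 2 1 0 3; term 4 11 0 1 2 4 3;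
       term 2 11 0 1 4 2 3; term 8 11 1 4 2 0 3; term 4 11 2 4 0 1 3]);
  ([:: 2; 2; 2; 2; 0]%N,
   [:: term (-26) 2 1 3 0 2 4; term 36 2 2 1 0 3 4; term 10 3 3 2 0 1 4;
       term 36 4 2 1 3 0 4; term 36 4 3 1 2 0 4; term 36 4 3 2 1 0 4;
       term (-72) 5 3 1 2 0 4; term 72 5 3 2 1 0 4; term 20 6 2 1 3 0 4;
       term (-36) 6 3 2 1 0 4; term (-20) 7 1 3 2 0 4; term 2 7 3 1 2 0 4;
       term 36 8 1 0 3 2 4; term (-36) 8 3 2 1 0 4])].

(* What is left of [scale] times the monomial [tm_id tau] after expanding it and
   applying [inverse_table]: here [term c k w] means [c] times the translate of
   [pjts k], that is, of PJTS_(k+1), by the permutation [w]. *)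
Definition kernel_table (tau : nat) : seq (int * tm) :=
  match tau with
  | 0 =>
      [:: term 144 0 0 1 2 3 4]
  | 7 =>
      [:: term (-144) 1 1 2 0 3 4]
  | 9 =>
      [:: term 288 2 2 0 1 3 4; term 8 4 3 1 2 0 4; term (-252) 1 2 0 3 1 4;
          term 8 4 0 3 2 1 4; term 4 4 3 2 0 1 4; term (-8) 1 0 3 1 2 4;
          term (-144) 0 1 0 3 2 4; term 4 4 1 3 0 2 4; term 4 3 0 1 3 2 4;
          term 4 3 2 1 3 0 4; term 16 3 1 2 3 0 4; term (-4) 1 1 3 2 0 4]
  | 10 =>
      [:: term (-8) 4 2 0 3 1 4; term (-8) 4 0 1 3 2 4; term (-4) 4 0 3 2 1 4;
          term (-4) 4 1 0 2 3 4; term 8 1 1 0 2 3 4; term 4 1 1 0 3 2 4;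
          term (-4) 3 2 0 1 3 4; term (-20) 3 3 0 1 2 4; term (-36) 1 0 2 1 3 4]
  | 11 =>
      [:: term (-72) 4 1 3 2 0 4; term 36 4 1 2 3 0 4; term (-36) 4 1 3 0 2 4;
          term (-36) 4 1 2 0 3 4; term 108 1 1 0 2 3 4; term (-36) 1 0 1 3 2 4;
          term 108 3 0 3 1 2 4; term (-36) 3 2 1 3 0 4; term 36 4 3 1 2 0 4]
  | _ => [::]
  end.

(** With this factor all entries of both tables are integers; it is inverted only in F, once the
    checks are done. *)
Definition scale : int := 288.

(** Shapes that the table omits are sent to zero. *)
Definition nf_row (c : seq nat) : seq (int * tm) :=
  foldr (fun r l => if r.1 == c then r.2 else l) [::] inverse_table.

(** Substituting the letters of [u] into a row makes the map equivariant by construction. *)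
Definition nf_inverse (u : nf nat) : seq (int * tm) :=
  lc_map (tm_map (nf_letter u)) (nf_row (nf_code u)).

Definition translate (k : tm) : seq (int * tm) :=
  lc_map (tm_map (word_fun k.2)) (pjts k.1).

Definition kernel_part (tau : nat) : seq (int * tm) :=
  lc_bind translate (kernel_table tau).

Lemma inverse_check :
  all (fun tau => lc_null (lc_scale (- scale) [:: (1, tm_id tau)]
         ++ lc_bind nf_inverse (tm_expand (tm_id tau)) ++ kernel_part tau))
    (iota 0 12).
Proof. by vm_compute. Qed.

Lemma pjts_check : all (fun k => lc_null (lc_bind tm_expand (pjts k))) (iota 0 5).
Proof. by vm_compute. Qed.

Definition word_list T (w : T * T * T * T * T) : seq T :=
  let: (i1, i2, i3, i4, i5) := w in [:: i1; i2; i3; i4; i5].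

(** On these keys [mon] is injective for every permutation of the variables, which is what reading
    off coefficients requires. *)
Definition tm_ok (k : tm) : bool :=
  (k.1 < 12)%N && perm_eq (word_list k.2) (iota 0 5).

Definition lc_coef (K : eqType) (k : K) (l : seq (int * K)) : int :=
  foldr (fun p s => if p.2 == k then p.1 + s else s) 0 l.

(* [scale] times the trace of the projection onto the kernel, divided by 5!. *)
Lemma trace_check :
  foldr (fun tau s => lc_coef (tm_id tau) (kernel_part tau) + s) 0 (iota 0 12) = 804.
Proof. by vm_compute. Qed.

Lemma pjts_ok : all (fun k => all (fun p => tm_ok p.2) (pjts k)) (iota 0 5).
Proof. by vm_compute. Qed.

Lemma kernel_table_ok :
  all (fun tau => all (fun p => (p.2.1 < 5)%N && perm_eq (word_list p.2.2) (iota 0 5))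
    (kernel_table tau)) (iota 0 12).
Proof. by vm_compute. Qed.

Lemma kernel_part_ok :
  all (fun tau => all (fun p => tm_ok p.2) (kernel_part tau)) (iota 0 12).
Proof. by vm_compute. Qed.

(* [weight 1] depends on the type only: the module generated by [pjts 1] has an
   S_5-invariant linear form that vanishes on what the others generate. *)
Definition weight (k : nat) (t : tm) : int :=
  match k with
  | 0 => (t == (5, (1, 2, 0, 3, 4)))%N%:Z - (t == (0, (0, 3, 2, 1, 4)))%N%:Z
  | 1 => 6 * (t.1 == 2)%N%:Z - 5 * (t.1 == 8)%N%:Z - 10 * (t.1 == 9)%N%:Z
  | 2 => (t == (9, (1, 2, 0, 3, 4)))%N%:Z
  | 3 => (t == (11, (0, 1, 3, 2, 4)))%N%:Z - (t == (11, (3, 1, 0, 2, 4)))%N%:Z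
  | _ => (t == (11, (2, 1, 3, 0, 4)))%N%:Z - (t == (11, (2, 0, 3, 1, 4)))%N%:Z
  end.

Definition lc_weight (k : nat) (f : nat -> nat) (l : seq (int * tm)) : int :=
  foldr (fun p s => p.1 * weight k (tm_map f p.2) + s) 0 l.

Lemma weight_check :
  all (fun w => all (fun k => all (fun l =>
      (l == k) || (lc_weight k (nth 0%N w) (pjts l) == 0)) (iota 0 5)) (iota 0 5))
    (permutations (iota 0 5)).
Proof. by vm_compute. Qed.

(** The five values are 1, 12, 1, 1 and 1. *)
Lemma weight_neq0 : all (fun k => lc_weight k id (pjts k) != 0) (iota 0 5).
Proof. by vm_compute. Qed.

Lemma eq_word_map (T : eqType) T' (f g : T -> T') w :
  {in word_list w, f =1 g} -> word_map f w = word_map g w.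
Proof.
case: w => [[[[i1 i2] i3] i4] i5] fg /=.
by rewrite !fg // !inE eqxx ?orbT.
Qed.

Lemma word_mapK T T' (f : T -> T') w : word_list (word_map f w) = map f (word_list w).
Proof. by case: w => [[[[i1 i2] i3] i4] i5]. Qed.

Lemma word_map_comp T T' T'' (f : T' -> T'') (g : T -> T') w :
  word_map f (word_map g w) = word_map (f \o g) w.
Proof. by case: w => [[[[i1 i2] i3] i4] i5]. Qed.

(** Naturality in the two ternary operations: the action on monomials and the expansion, actual or
    symbolic, are instances. *)
Lemma compose2_morph X Y (f : X -> Y) t1 t2 u1 u2 tau w :
  (forall a b c, f (t1 a b c) = u1 (f a) (f b) (f c)) ->
  (forall a b c, f (t2 a b c) = u2 (f a) (f b) (f c)) ->
  f (compose2 t1 t2 tau w) = compose2 u1 u2 tau (word_map f w).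
Proof.
move=> f1 f2; case: w => [[[[a b] c] d] e].
by do 11?[case: tau => [|tau]]; rewrite /compose2 /word_map ?(f1, f2).
Qed.

Lemma word_list_inj T : injective (@word_list T).
Proof.
by move=> [[[[i1 i2] i3] i4] i5] [[[[j1 j2] j3] j4] j5] [-> -> -> -> ->].
Qed.

Lemma word_funE w i : word_fun w i = nth 0%N (word_list w) i.
Proof. by case: w => [[[[i1 i2] i3] i4] i5]. Qed.

Lemma all_iotaP (P : pred nat) n k : all P (iota 0 n) -> (k < n)%N -> P k.
Proof. by move=> /allP aP kn; apply: aP; rewrite mem_iota. Qed.

(** * Ternary monomials by type and word *)

Section Monomials.
Variable n : nat.

Definition mon (r : nat -> 'I_n) (k : tm) : ttmon n :=
  compose2 (@TT1 n) (@TT2 n) k.1 (word_map (fun i => TTvar (r i)) k.2).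

Lemma mon_map r f k : mon r (tm_map f k) = mon (r \o f) k.
Proof. by case: k => tau w; rewrite /mon /= word_map_comp. Qed.

Lemma eq_mon r r' k : {in word_list k.2, r =1 r'} -> mon r k = mon r' k.
Proof. by move=> e; congr compose2; apply: eq_word_map => i /e /= ->. Qed.

Lemma mon_act s r k : ttmon_act s (mon r k) = mon (s \o r) k.
Proof.
rewrite (compose2_morph (u1 := @TT1 n) (u2 := @TT2 n) (f := ttmon_act s)) //.
by rewrite word_map_comp.
Qed.

Lemma mon_vars r k : ttmon_vars (mon r k) = map r (word_list k.2).
Proof.
by case: k => tau [[[[a b] c] d] e]; rewrite /mon /=; do 12?[case: tau => [|tau] //].
Qed.

(** Recovers the type and the letters from a monomial. It separates the monomials [mon r k] and lets
    linear forms be given by type and word. *)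
Definition ttmon_key (m : ttmon n) : option tm :=
  match m with
  | TT1 (TT1 (TTvar a) (TTvar b) (TTvar c)) (TTvar d) (TTvar e) =>
      Some (0, (val a, val b, val c, val d, val e))
  | TT1 (TT2 (TTvar a) (TTvar b) (TTvar c)) (TTvar d) (TTvar e) =>
      Some (1, (val a, val b, val c, val d, val e))
  | TT2 (TT1 (TTvar a) (TTvar b) (TTvar c)) (TTvar d) (TTvar e) =>
      Some (2, (val a, val b, val c, val d, val e))
  | TT2 (TT2 (TTvar a) (TTvar b) (TTvar c)) (TTvar d) (TTvar e) =>
      Some (3, (val a, val b, val c, val d, val e))
  | TT1 (TTvar a) (TT1 (TTvar b) (TTvar c) (TTvar d)) (TTvar e) =>
      Some (4, (val a, val b, val c, val d, val e))
  | TT1 (TTvar a) (TT2 (TTvar b) (TTvar c) (TTvar d)) (TTvar e) =>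
      Some (5, (val a, val b, val c, val d, val e))
  | TT2 (TTvar a) (TT1 (TTvar b) (TTvar c) (TTvar d)) (TTvar e) =>
      Some (6, (val a, val b, val c, val d, val e))
  | TT2 (TTvar a) (TT2 (TTvar b) (TTvar c) (TTvar d)) (TTvar e) =>
      Some (7, (val a, val b, val c, val d, val e))
  | TT1 (TTvar a) (TTvar b) (TT1 (TTvar c) (TTvar d) (TTvar e)) =>
      Some (8, (val a, val b, val c, val d, val e))
  | TT1 (TTvar a) (TTvar b) (TT2 (TTvar c) (TTvar d) (TTvar e)) =>
      Some (9, (val a, val b, val c, val d, val e))
  | TT2 (TTvar a) (TTvar b) (TT1 (TTvar c) (TTvar d) (TTvar e)) =>
      Some (10, (val a, val b, val c, val d, val e))
  | TT2 (TTvar a) (TTvar b) (TT2 (TTvar c) (TTvar d) (TTvar e)) =>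
      Some (11, (val a, val b, val c, val d, val e))
  | _ => None
  end%N.

Lemma mon_key r k : (k.1 < 12)%N ->
  ttmon_key (mon r k) = Some (k.1, word_map (val \o r) k.2).
Proof.
case: k => tau [[[[a b] c] d] e] /=; rewrite /mon /=.
by do 12?[case: tau => [|tau] //].
Qed.

Lemma ttmon_size1 (m : ttmon n) : size (ttmon_vars m) = 1%N -> exists a, m = TTvar a.
Proof.
have gt0 (u : ttmon n) : (0 < size (ttmon_vars u))%N.
  by elim: u => //= u IH v _ w _; rewrite !size_cat addn_gt0 IH.
case: m => [a _|u v w|u v w] /=; first by exists a.
all: by rewrite !size_cat; have := gt0 u; have := gt0 v; have := gt0 w; lia.
Qed.

(** Parity forces three factors of total length 5 to have lengths 3, 1, 1 in some order, and three
    factors of total length 3 to be variables. *)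
Lemma ttmon_odd (m : ttmon n) : odd (size (ttmon_vars m)).
Proof. by elim: m => //= u IHu v IHv w IHw; rewrite !size_cat !oddD IHu IHv IHw. Qed.

Lemma ttmon_size3 (m : ttmon n) : size (ttmon_vars m) = 3 ->
  exists b u v w, m = (if b then @TT1 n else @TT2 n) (TTvar u) (TTvar v) (TTvar w).
Proof.
case: m => // u v w /=; rewrite !size_cat;
  have := ttmon_odd u; have := ttmon_odd v; have := ttmon_odd w => ow ov ou e.
all: have [i ->] : exists a, u = TTvar a by apply: ttmon_size1; lia.
all: have [j ->] : exists a, v = TTvar a by apply: ttmon_size1; lia.
all: have [k ->] : exists a, w = TTvar a by apply: ttmon_size1; lia.
  by exists true, i, j, k.
by exists false, i, j, k.
Qed.

Lemma ttmon_size5 (m : ttmon n) : size (ttmon_vars m) = 5 ->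
  exists2 tau, (tau < 12)%N & exists a b c d e,
    m = compose2 (@TT1 n) (@TT2 n) tau
          (TTvar a, TTvar b, TTvar c, TTvar d, TTvar e).
Proof.
(* The Boolean selects the operation at the root; with that of the inner factor and its position it
   gives the 2 · 2 · 3 = 12 types. *)
have node b (u v w : ttmon n) :
    (size (ttmon_vars u) + (size (ttmon_vars v) + size (ttmon_vars w)) = 5)%N ->
  exists2 tau, (tau < 12)%N & exists a1 b1 c d e,
    (if b then @TT1 n else @TT2 n) u v w = compose2 (@TT1 n) (@TT2 n) tau
          (TTvar a1, TTvar b1, TTvar c, TTvar d, TTvar e).
  have := ttmon_odd u; have := ttmon_odd v; have := ttmon_odd w => ow ov ou e.
  have [e3|[e3|e3]] : size (ttmon_vars u) = 3 \/ size (ttmon_vars v) = 3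
      \/ size (ttmon_vars w) = 3 by lia.
  - have [b' [i1 [i2 [i3 ->]]]] := ttmon_size3 e3.
    have [i4 ->] : exists a, v = TTvar a by apply: ttmon_size1; lia.
    have [i5 ->] : exists a, w = TTvar a by apply: ttmon_size1; lia.
    exists (if b then if b' then 0 else 1 else if b' then 2 else 3)%N.
      by case: b; case: b'.
    by exists i1, i2, i3, i4, i5; case: b; case: b'.
  - have [b' [i2 [i3 [i4 ->]]]] := ttmon_size3 e3.
    have [i1 ->] : exists a, u = TTvar a by apply: ttmon_size1; lia.
    have [i5 ->] : exists a, w = TTvar a by apply: ttmon_size1; lia.
    exists (if b then if b' then 4 else 5 else if b' then 6 else 7)%N.
      by case: b; case: b'.
    by exists i1, i2, i3, i4, i5; case: b; case: b'.
  - have [b' [i3 [i4 [i5 ->]]]] := ttmon_size3 e3.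
    have [i1 ->] : exists a, u = TTvar a by apply: ttmon_size1; lia.
    have [i2 ->] : exists a, v = TTvar a by apply: ttmon_size1; lia.
    exists (if b then if b' then 8 else 9 else if b' then 10 else 11)%N.
      by case: b; case: b'.
    by exists i1, i2, i3, i4, i5; case: b; case: b'.
case: m => // u v w /=; rewrite !size_cat => e.
- exact: (node true).
- exact: (node false).
Qed.

(** Both sides are [compose2] of the pre-Jordan triple products, so naturality reduces the claim to
    single letters. *)
Lemma tm_expandP (F : fieldType) (D : dendriformType F) (x : 'I_n -> D) r k :
  ttmon_expand x (mon r k) = lc_eval (nf_eval (x \o r)) (tm_expand k).
Proof.
pose pj2 t1 t2 t3 := pre_jordan (@pre_jordan F D t1 t2) t3.
pose pj2' t1 t2 t3 := pre_jordan t1 (@pre_jordan F D t2 t3).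
rewrite (compose2_morph (u1 := pj2) (u2 := pj2') (f := ttmon_expand x)) //.
rewrite (compose2_morph (u1 := pj2) (u2 := pj2') (f := lc_eval (nf_eval (x \o r)))).
- rewrite !word_map_comp; congr compose2.
  by apply: eq_word_map => i _ /=; rewrite lc_eval1.
- by move=> l1 l2 l3; rewrite !lc_pj_eval.
- by move=> l1 l2 l3; rewrite !lc_pj_eval.
Qed.

End Monomials.

Lemma nf_code_map T T' (f : T -> T') u : nf_code (nf_map f u) = nf_code u.
Proof. by elim: u => //= [a v ->|a v ->|a v -> w ->]. Qed.

Lemma nf_letters_map T T' (f : T -> T') u :
  nf_letters (nf_map f u) = map f (nf_letters u).
Proof. by elim: u => //= [a v ->|a v ->|a v -> w ->]; rewrite ?map_cat. Qed.

Lemma nf_letter_map T T' (f : T -> T') u i :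
  nf_letter (nf_map f u) i = f (nf_letter u i).
Proof.
have headE : nf_head (nf_map f u) = f (nf_head u) by case: u.
rewrite /nf_letter nf_letters_map headE.
have [ilt|ige] := ltnP i (size (nf_letters u)); first exact: nth_map.
by rewrite !nth_default ?size_map.
Qed.

(** * The equivariant inverse modulo the generators *)

Section Inverse.
Variable F : fieldType.
Notation TT5 := {malg F[ttmon 5]}.
Notation A := (free_dend F 'I_5).

Definition mono (r : nat -> 'I_5) (k : tm) : TT5 := << mon r k >>.

Definition inverse_op : A -> TT5 :=
  lin_ext (fun u => lc_eval (mono (nf_letter u)) (nf_row (nf_code u))).

HB.instance Definition _ := GRing.isLinear.Build F A TT5 *:%R inverse_op
  (lin_ext_is_linear _).

Lemma inverse_opP c t s : inverse_op (c *: t + s) = c *: inverse_op t + inverse_op s.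
Proof. exact: linearP. Qed.

Lemma lc_eval_mono_map r f l :
  lc_eval (mono r) (lc_map (tm_map f) l) = lc_eval (mono (r \o f)) l.
Proof. by rewrite lc_eval_map; apply: eq_lc_eval => k; rewrite /mono /= mon_map. Qed.

Lemma inverse_opU r u :
  inverse_op (nf_mk F (nf_map r u)) = lc_eval (mono r) (nf_inverse u).
Proof.
rewrite /inverse_op lin_extU nf_code_map lc_eval_mono_map.
by apply: eq_lc_eval => k; congr mkmalgU; apply: eq_mon => i _; apply: nf_letter_map.
Qed.

Lemma inverse_opE r tau : (tau < 12)%N ->
  inverse_op (ttmon_expand (fun i => nf_mk F (NV i) : A) (mon r (tm_id tau)))
  = scale%:~R *: mono r (tm_id tau) - lc_eval (mono r) (kernel_part tau).
Proof.
move=> tau12; have := all_iotaP inverse_check tau12.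
move=> /(lc_nullP (mono r)); rewrite !lc_eval_cat lc_eval_scale lc_eval1 lc_eval_bind.
rewrite tm_expandP lc_eval_linear.
set s1 := lc_eval _ (tm_expand _); set s2 := lc_eval _ (tm_expand _).
(* At the generators of the model, [u] with its letters renamed by [r] takes as value the basis
   vector of [nf_map r u], on which [inverse_op] is read off the table. *)
have -> : s1 = s2.
  apply: eq_lc_eval => u /=; rewrite -inverse_opU; congr (inverse_op _).
  by rewrite -nf_eval_map free_dend_eval.
by rewrite mulrNz scaleNr addrC => /eqP; rewrite subr_eq0 => /eqP <-; rewrite addrK.
Qed.

End Inverse.

(** * The kernel of the expansion map *)

Fixpoint dd_of_nf n (u : nf 'I_n) : ddmon n :=
  match u with
  | NV a => DDvar a
  | NP a v => DDprec (DDvar a) (dd_of_nf v)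
  | NS a v => DDsucc (DDvar a) (dd_of_nf v)
  | NQ a v w => DDsucc (DDsucc (DDvar a) (dd_of_nf v)) (dd_of_nf w)
  end.

Lemma ddmon_normalP n (m : ddmon n) : ddmon_normal m -> exists u, m = dd_of_nf u.
Proof.
elim: m => [i _|u IHu v IHv|u IHu v IHv].
- by exists (NV i).
- by case: u IHu => // i _ /IHv[w ->]; exists (NP i w).
- case: u IHu => // [i _ /IHv[w ->]|]; first by exists (NS i w).
  case=> // i u IHu /= /andP[/IHu[w]].
  (* The induction hypothesis concerns the whole left factor [x ≻ u], and only [NS] yields a
     monomial of that form. *)
  by case: w => // j w [-> ->] /IHv[w' ->]; exists (NQ j w w').
Qed.

Lemma ddmon_eval_nf (F : fieldType) (D : dendriformType F) n (x : 'I_n -> D) u :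
  ddmon_eval x (dd_of_nf u) = nf_eval x u.
Proof. by elim: u => //= [a v ->|a v ->|a v -> w ->]. Qed.

Section CharacteristicZero.
Variables (F : fieldType) (F_char0 : [pchar F] =i pred0).

Lemma intr_neq0 (c : int) : c != 0 -> c%:~R != 0 :> F.
Proof.
have F0 := (pcharf0P F).1 F_char0.
case: c => [k|k] k0; first by rewrite -pmulrn F0.
by rewrite NegzE mulrNz oppr_eq0 -pmulrn F0.
Qed.

End CharacteristicZero.

(** * The symmetric group action and the expansion *)

Section MultilinearPart.
Variables (F : fieldType) (n : nat).
Implicit Types (t : {malg F[ttmon n]}) (s : 'S_n).

Lemma TT0 : TT (0 : {malg F[ttmon n]}).
Proof. by move=> m; rewrite msupp0. Qed.

Lemma TTU m : ttmon_multilinear m -> TT (<< m >> : {malg F[ttmon n]}).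
Proof. by move=> mm k /(fsubsetP msuppU_le); rewrite in_fset1 => /eqP ->. Qed.

Lemma TT_P (c : F) t u : TT t -> TT u -> TT (c *: t + u).
Proof.
move=> tt tu m /(fsubsetP (msuppD_le _ _)); rewrite in_fsetU => /orP[|/tu//].
by move=> /(fsubsetP (msuppZ_le _ _))/tt.
Qed.

Lemma TT_sum (I : Type) (r : seq I) (P : pred I) (c : I -> F)
    (f : I -> {malg F[ttmon n]}) :
  (forall i, P i -> TT (f i)) -> TT (\sum_(i <- r | P i) c i *: f i).
Proof.
move=> tf; elim: r => [|i r IH]; first by rewrite big_nil; apply: TT0.
by rewrite big_cons; case: ifP => // /tf ti; apply: TT_P.
Qed.

Lemma ttmon_vars_act s (m : ttmon n) : ttmon_vars (ttmon_act s m) = map s (ttmon_vars m).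
Proof. by elim: m => //= u -> v -> w ->; rewrite !map_cat. Qed.

Lemma ttmon_multilinear_act s (m : ttmon n) :
  ttmon_multilinear m -> ttmon_multilinear (ttmon_act s m).
Proof.
rewrite /ttmon_multilinear ttmon_vars_act => mm.
apply: (perm_trans (perm_map s mm)); apply: uniq_perm; rewrite ?enum_uniq //.
  by rewrite map_inj_uniq ?enum_uniq //; apply: perm_inj.
by move=> i; rewrite -{1}[i](permKV s) mem_map ?mem_enum //; apply: perm_inj.
Qed.

Lemma TT_act_TT s t : TT t -> TT (TT_act s t).
Proof.
move=> tt; rewrite /TT_act /lin_ext big_seq_cond.
by apply: TT_sum => m /andP[/tt mm _]; apply: TTU; apply: ttmon_multilinear_act.
Qed.

Lemma TT_actP s (c : F) t u : TT_act s (c *: t + u) = c *: TT_act s t + TT_act s u.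
Proof. exact: lin_ext_is_linear. Qed.

Lemma TT_actU s m : TT_act s << m >> = << ttmon_act s m >> :> {malg F[ttmon n]}.
Proof. exact: lin_extU. Qed.

Lemma ttmon_actM s s' (m : ttmon n) :
  ttmon_act s' (ttmon_act s m) = ttmon_act (s * s')%g m.
Proof. by elim: m => /= [i|u -> v -> w ->|u -> v -> w ->] //; rewrite permM. Qed.

Lemma TT_actM s s' t : TT_act s' (TT_act s t) = TT_act (s * s')%g t.
Proof.
apply: (lin_ext_unique (f := fun t => TT_act s' (TT_act s t))
  (g := TT_act (s * s')%g)) => [c u v|c u v|m].
- by rewrite !TT_actP.
- exact: TT_actP.
- by rewrite !TT_actU ttmon_actM.
Qed.

Lemma Sn_generated_submodule (G : {malg F[ttmon n]} -> Prop) :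
  Sn_submodule (Sn_generated G).
Proof.
split=> [U [] //|c u v gu gv U Us UG|s u gu U Us UG].
- have [_ UP _] := Us; exact: UP (gu U Us UG) (gv U Us UG).
- have [_ _ Ua] := Us; exact: Ua (gu U Us UG).
Qed.

Lemma Sn_submodule_sum (U : {malg F[ttmon n]} -> Prop) (I : Type) (r : seq I)
    (P : pred I) (c : I -> F) (f : I -> {malg F[ttmon n]}) :
  Sn_submodule U -> (forall i, P i -> U (f i)) -> U (\sum_(i <- r | P i) c i *: f i).
Proof.
move=> [U0 UP _] Uf; elim: r => [|i r IH]; first by rewrite big_nil.
by rewrite big_cons; case: ifP => // /Uf Ui; apply: UP.
Qed.

Variables (D : dendriformType F) (x : 'I_n -> D).

Lemma expansionP c t u : expansion x (c *: t + u) = c *: expansion x t + expansion x u.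
Proof. exact: lin_ext_is_linear. Qed.

Lemma expansionU m : expansion x << m >> = ttmon_expand x m.
Proof. exact: lin_extU. Qed.

Lemma expansion_morph (D' : dendriformType F) (h : D -> D') t :
  dendriform_morphism h -> h (expansion x t) = expansion (h \o x) t.
Proof.
move=> hm; have [hl _ _] := hm.
apply: (lin_ext_unique (f := fun t => h (expansion x t))
  (g := expansion (h \o x))) => [c u v|c u v|m].
- by rewrite expansionP hl.
- exact: lin_ext_is_linear.
- by rewrite /expansion !lin_extU ttmon_expand_morph.
Qed.

Lemma ttmon_expand_act s m : ttmon_expand x (ttmon_act s m) = ttmon_expand (x \o s) m.
Proof. by elim: m => //= u -> v -> w ->. Qed.

Lemma expansion_act s t : expansion x (TT_act s t) = expansion (x \o s) t.
Proof.
apply: (lin_ext_unique (f := fun t => expansion x (TT_act s t))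
  (g := expansion (x \o s))) => [c u v|c u v|m].
- by rewrite TT_actP expansionP.
- exact: lin_ext_is_linear.
- by rewrite TT_actU /expansion !lin_extU ttmon_expand_act.
Qed.

(** By freeness a permutation of the generators extends to an endomorphism of [D], which carries the
    expansion of an element to that of its translate. *)
Lemma expansion_ker_submodule : free_dendriform x -> Sn_submodule (expansion_ker x).
Proof.
move=> Dfree; split=> [|c u v [tu eu] [tv ev]|s u [tu eu]].
- by split; [exact: TT0|rewrite /expansion raddf0].
- by split; [exact: TT_P|rewrite expansionP eu ev scaler0 addr0].
- split; first exact: TT_act_TT.
  have [h [hm hx _]] := Dfree _ (x \o s).
  have -> : expansion x (TT_act s u) = h (expansion x u).
    rewrite expansion_act expansion_morph //; apply: eq_bigr => m _.
    by congr (_ *: _); elim: m => //= u' -> v -> w ->.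
  rewrite eu; have [hl _ _] := hm; have := hl (-1) 0 0.
  by rewrite scaler0 addr0 scaleN1r addNr.
Qed.

End MultilinearPart.

(** * Degree five *)

Section DegreeFive.
Variable F : fieldType.
Notation TT5 := {malg F[ttmon 5]}.

(* Left-nested form of [lc_eval], convertible to a displayed sum. *)
Fixpoint lc_chain K (V : lmodType F) (f : K -> V) (t : V) (l : seq (int * K)) : V :=
  match l with
  | [::] => t
  | (Posz 1, k) :: l' => lc_chain f (t + f k) l'
  | (Negz 0, k) :: l' => lc_chain f (t - f k) l'
  | (c, k) :: l' => lc_chain f (t + c%:~R *: f k) l'
  end.

Lemma lc_chainE K (V : lmodType F) (f : K -> V) t l :
  lc_chain f t l = t + lc_eval f l.
Proof.
elim: l t => [|[c k] l IH] t; first by rewrite lc_eval_nil addr0.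
rewrite lc_eval_cons addrA; case: c => [[|[|c]]|[|c]]; rewrite /= IH //.
- by rewrite scale1r.
- by rewrite scaleN1r.
Qed.

Ltac displayed_sum :=
  match goal with |- _ = lc_eval ?f ?l =>
    let l' := eval cbv beta iota delta [pjts term] in l in
    match l' with ?p :: ?r =>
      transitivity (lc_chain f (f p.2) r);
      [cbv beta iota zeta delta [PJTS1 PJTS2 PJTS3 PJTS4 PJTS5 lc_chain snd]; reflexivity
      | rewrite lc_chainE; by rewrite [RHS]lc_eval_cons scale1r]
    end
  end.

Lemma PJTS1_mono : PJTS1 F = lc_eval (mono F inord) (pjts 0).
Proof. displayed_sum. Qed.

Lemma PJTS2_mono : PJTS2 F = lc_eval (mono F inord) (pjts 1).
Proof. displayed_sum. Qed.

Lemma PJTS3_mono : PJTS3 F = lc_eval (mono F inord) (pjts 2).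
Proof. displayed_sum. Qed.

Lemma PJTS4_mono : PJTS4 F = lc_eval (mono F inord) (pjts 3).
Proof. displayed_sum. Qed.

Lemma PJTS5_mono : PJTS5 F = lc_eval (mono F inord) (pjts 4).
Proof. displayed_sum. Qed.

Lemma PJTS_mono (k : 'I_5) : PJTS F k = lc_eval (mono F inord) (pjts k).
Proof.
case: k => [[|[|[|[|[|k]]]]] k5]; last by [].
- exact: PJTS1_mono.
- exact: PJTS2_mono.
- exact: PJTS3_mono.
- exact: PJTS4_mono.
- exact: PJTS5_mono.
Qed.

Lemma TT_act_mono s r l :
  TT_act s (lc_eval (mono F r) l) = lc_eval (mono F (s \o r)) l.
Proof.
rewrite /TT_act lc_eval_linear; apply: eq_lc_eval => k.
by rewrite /= lin_extU mon_act.
Qed.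

Definition perm_fun (s : 'S_5) (i : nat) : 'I_5 := s (inord i).

Lemma perm_fun_inj s : {in gtn 5 &, injective (perm_fun s)}.
Proof.
move=> i j; rewrite !inE => i5 j5 e.
by have := congr1 val (perm_inj e); rewrite /= !inordK.
Qed.

Lemma tm_ok_lt k : tm_ok k -> {in word_list k.2, forall i, i < 5}%N.
Proof. by case/andP=> _ kp i; rewrite (perm_mem kp) mem_iota. Qed.

Lemma mon_inj s k k' : tm_ok k -> tm_ok k' ->
  mon (perm_fun s) k = mon (perm_fun s) k' -> k = k'.
Proof.
move=> ok ok' /(congr1 (@ttmon_key 5)); rewrite !mon_key;
  try by case/andP: ok; case/andP: ok'.
case: k k' ok ok' => [tau w] [tau' w'] ok ok' [-> e]; congr (_, _).
apply: word_list_inj; move/(congr1 (@word_list nat)): e; rewrite !word_mapK.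
have valinj : {in gtn 5 &, injective (val \o perm_fun s)}.
  by move=> i j i5 j5 /val_inj; apply: perm_fun_inj.
by move/(inj_in_map valinj); apply; apply/allP => i;
  [move/(tm_ok_lt ok)|move/(tm_ok_lt ok')].
Qed.

(** Injectivity of [mon] on admissible keys keeps different entries of the list from merging when
    variables are substituted. *)
Lemma mono_coef s k l : tm_ok k -> all (fun p => tm_ok p.2) l ->
  (lc_eval (mono F (perm_fun s)) l)@_(mon (perm_fun s) k) = (lc_coef k l)%:~R.
Proof.
move=> ok; elim: l => [_|p l IH] /=; first by rewrite lc_eval_nil mcoeff0.
move=> /andP[okp /IH E]; rewrite lc_eval_cons mcoeffD mcoeffZ E /mono mcoeffU.
have -> : (mon (perm_fun s) p.2 == mon (perm_fun s) k) = (p.2 == k).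
  by apply/eqP/eqP => [|-> //]; apply: mon_inj.
by case: eqP => _; rewrite ?mulr1n ?mulr0n ?mulr1 ?mulr0 ?add0r // intrD.
Qed.

Lemma eq_mono_tm_ok r r' l : all (fun p => tm_ok p.2) l ->
  (forall i, (i < 5)%N -> r i = r' i) ->
  lc_eval (mono F r) l = lc_eval (mono F r') l.
Proof.
move=> /allP lok rr; rewrite /lc_eval big_seq [RHS]big_seq; apply: eq_bigr => p /lok ok.
by rewrite /mono (eq_mon (r' := r')) // => i /(tm_ok_lt ok); apply: rr.
Qed.

Lemma pjts_tm_ok (k : 'I_5) : all (fun p => tm_ok p.2) (pjts k).
Proof. exact: all_iotaP pjts_ok (ltn_ord k). Qed.

Lemma word_perm w : perm_eq w (iota 0 5) ->
  exists s : 'S_5, forall i, (i < 5)%N -> s (inord i) = inord (nth 0%N w i).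
Proof.
move=> wp; have w5 i : (i < 5)%N -> (nth 0%N w i < 5)%N.
  by move=> i5; have := mem_nth 0%N (s := w) (n := i);
    rewrite (perm_mem wp) mem_iota (perm_size wp) size_iota; apply.
have finj : injective (fun i : 'I_5 => inord (nth 0%N w i) : 'I_5).
  move=> i j /(congr1 val); rewrite /= !inordK ?w5 // => /eqP.
  rewrite nth_uniq ?(perm_size wp) ?size_iota // ?(perm_uniq wp) ?iota_uniq //.
  by move/eqP/val_inj.
by exists (perm finj) => i i5; rewrite permE inordK.
Qed.

Lemma mon_perm_multilinear s k : tm_ok k -> ttmon_multilinear (mon (perm_fun s) k).
Proof.
move=> ok; have [_ kp] := andP ok; rewrite /ttmon_multilinear mon_vars.
apply: (perm_trans (perm_map _ kp)); apply: uniq_perm; rewrite ?enum_uniq //.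
  rewrite map_inj_in_uniq ?iota_uniq // => i j; rewrite !mem_iota.
  exact: perm_fun_inj.
move=> i; rewrite mem_enum; apply/mapP; exists (val (s^-1%g i)).
  by rewrite mem_iota /=.
by rewrite /perm_fun inord_val permKV.
Qed.

Lemma multilinear_mon (m : ttmon 5) : ttmon_multilinear m ->
  exists2 tau, (tau < 12)%N & exists s, m = mon (perm_fun s) (tm_id tau).
Proof.
move=> mm; have /ttmon_size5[tau tau12 [a [b [c [d [e mE]]]]]] : size (ttmon_vars m) = 5.
  by rewrite (perm_size mm) size_enum_ord.
(* The default [a] is never reached: only positions below 5 occur in [tm_id tau]. *)
exists tau => //; pose r i := nth a [:: a; b; c; d; e] i.
have {mE} mE : m = mon r (tm_id tau) by rewrite mE.
have rinj : injective (fun i : 'I_5 => r i).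
  have : uniq (map r (iota 0 5)).
    by have := perm_uniq mm; rewrite mE mon_vars enum_uniq /=.
  move=> /= u i j /eqP; rewrite /r nth_uniq //; first by move/eqP/val_inj.
exists (perm rinj); rewrite mE; apply: eq_mon => i i5.
rewrite /perm_fun permE inordK //.
by move: i5; rewrite !inE; case/or4P => [/eqP->|/eqP->|/eqP->|/orP[]/eqP->].
Qed.

Lemma tm_id_ok tau : (tau < 12)%N -> tm_ok (tm_id tau).
Proof. by move=> ?; rewrite /tm_ok /= andbT. Qed.

Notation PJTS_span := (Sn_generated (fun g => exists k, g = PJTS F k)).

Lemma kernel_part_span s tau : (tau < 12)%N ->
  PJTS_span (lc_eval (mono F (perm_fun s)) (kernel_part tau)).
Proof.
move=> tau12.
have [_ _ spanA] := Sn_generated_submodule (fun g => exists k, g = PJTS F k).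
rewrite lc_eval_bind /lc_eval big_seq.
apply: Sn_submodule_sum => [|[c [k w]] kw /=]; first exact: Sn_generated_submodule.
have /allP/(_ _ kw)/andP[/= k5 wp] := all_iotaP kernel_table_ok tau12.
have [s' s'w] := word_perm wp.
rewrite -/(lc_eval _ _) /translate /= lc_eval_mono_map.
(* Products of permutations apply the left factor first, so the translate by [s'], with its letters
   renamed along [s], is the translate by [s' * s]. *)
rewrite (eq_mono_tm_ok (r' := perm_fun (s' * s)) (pjts_tm_ok (Ordinal k5))) => [|i i5].
  have -> : lc_eval (mono F (perm_fun (s' * s))) (pjts (Ordinal k5))
          = TT_act (s' * s)%g (PJTS F (Ordinal k5)).
    by rewrite PJTS_mono TT_act_mono.
  by apply: spanA => U _; apply; exists (Ordinal k5).
by rewrite /= /perm_fun permM s'w // word_funE.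
Qed.

(* [scale] times the projection of TT_5 onto the kernel. *)
Definition ker_proj : TT5 -> TT5 :=
  lin_ext (fun m => scale%:~R *: << m >>
    - inverse_op (ttmon_expand (fun i => nf_mk F (NV i) : free_dend F 'I_5) m)).

Lemma ker_projE t : ker_proj t = scale%:~R *: t
  - inverse_op (expansion (fun i => nf_mk F (NV i) : free_dend F 'I_5) t).
Proof.
apply: (lin_ext_unique (f := ker_proj) (g := fun t => scale%:~R *: t
  - inverse_op (expansion (fun i => nf_mk F (NV i) : free_dend F 'I_5) t)))
  => [|c u v|m].
- exact: lin_ext_is_linear.
- rewrite expansionP inverse_opP scalerDr !scalerA mulrC -scalerA opprD addrACA.
  by rewrite scalerBr.
- by rewrite /ker_proj /expansion !lin_extU.
Qed.

Lemma ker_proj_mon s tau : (tau < 12)%N ->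
  ker_proj << mon (perm_fun s) (tm_id tau) >>
  = lc_eval (mono F (perm_fun s)) (kernel_part tau).
Proof.
by move=> tau12; rewrite ker_projE expansionU inverse_opE // opprB addrC subrK.
Qed.

Lemma ker_proj_span t : TT t -> PJTS_span (ker_proj t).
Proof.
move=> tt; rewrite /ker_proj /lin_ext big_seq.
apply: Sn_submodule_sum => [|m /tt]; first exact: Sn_generated_submodule.
move=> /multilinear_mon[tau tau12 [s ->]]; have := ker_proj_mon s tau12.
by rewrite /ker_proj lin_extU => ->; apply: kernel_part_span.
Qed.

End DegreeFive.

(** * The kernel is generated by the five elements *)

Section KernelBasis.
Variable F : fieldType.
Notation TT5 := {malg F[ttmon 5]}.
Notation PJTS_span := (Sn_generated (fun g => exists k, g = PJTS F k)).

Lemma PJTS_TT (k : 'I_5) : TT (PJTS F k).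
Proof.
rewrite PJTS_mono /lc_eval big_seq; apply: TT_sum => p pk; apply: TTU.
have /allP/(_ _ pk) ok := pjts_tm_ok k.
have -> : mon inord p.2 = mon (perm_fun 1) p.2.
  by apply: eq_mon => i _; rewrite /perm_fun perm1.
exact: mon_perm_multilinear.
Qed.

Lemma PJTS_expansion (D : dendriformType F) (x : 'I_5 -> D) (k : 'I_5) :
  expansion x (PJTS F k) = 0.
Proof.
rewrite PJTS_mono -(lc_nullP (nf_eval (x \o inord)) (all_iotaP pjts_check (ltn_ord k))).
rewrite lc_eval_bind /expansion lc_eval_linear; apply: eq_lc_eval => p /=.
by rewrite lin_extU tm_expandP.
Qed.

Section Kernel.
Hypothesis F_char0 : [pchar F] =i pred0.
Variables (D : dendriformType F) (x : 'I_5 -> D).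
Hypothesis D_free : free_dendriform x.

Lemma PJTS_span_ker t : PJTS_span t -> expansion_ker x t.
Proof.
apply; first exact: expansion_ker_submodule.
by move=> _ [k ->]; split; [exact: PJTS_TT|exact: PJTS_expansion].
Qed.

(** The expansion in the model is the image of the expansion in [D], hence zero here, and the
    subtracted term of [ker_projE] disappears. *)
Lemma ker_proj_ker t : expansion_ker x t -> ker_proj t = scale%:~R *: t.
Proof.
case=> _ et; have [h [hm hx _]] := free_dendriform_normal D_free.
have hl0 : h 0 = 0.
  by case: hm => hl _ _; have := hl (-1) 0 0; rewrite scaler0 addr0 scaleN1r addNr.
rewrite ker_projE; set y := fun i => _.
have -> : expansion y t = h (expansion x t).
  rewrite expansion_morph //; apply: eq_bigr => m _; congr (_ *: _).
  by elim: m => //= u -> v -> w ->.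
by rewrite et hl0 /inverse_op raddf0 subr0.
Qed.

Lemma scale_neq0 : scale%:~R != 0 :> F.
Proof. exact: intr_neq0. Qed.

Lemma ker_PJTS_span t : expansion_ker x t -> PJTS_span t.
Proof.
move=> kt; have -> : t = (scale%:~R)^-1 *: ker_proj t + 0.
  by rewrite ker_proj_ker // addr0 scalerA mulVf ?scale1r // scale_neq0.
have [S0 SP _] := Sn_generated_submodule (fun g => exists k, g = PJTS F k).
by apply: SP => //; apply: ker_proj_span; case: kt.
Qed.

End Kernel.

(** * Independence of the generators *)

Section Independence.

Definition weight_form (k : nat) : TT5 -> F :=
  lin_ext (V := F^o) (fun m => (oapp (weight k) 0 (ttmon_key m))%:~R : F^o).

Lemma weight_formP k c t u :
  weight_form k (c *: t + u) = c * weight_form k t + weight_form k u.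
Proof. exact: (lin_ext_is_linear (V := F^o)). Qed.

Lemma weight_form_mono k r l : all (fun p => tm_ok p.2) l ->
  weight_form k (lc_eval (mono F r) l) = (lc_weight k (val \o r) l)%:~R.
Proof.
rewrite /weight_form (lc_eval_linear (V := TT5) (W := F^o)).
elim: l => [_|p l IH] /=; first exact: (lc_eval_nil (V := F^o)).
move=> /andP[/andP[p12 _] lok]; rewrite lc_eval_cons IH //.
by rewrite /= lin_extU mon_key //= intrD intrM.
Qed.

Lemma weight_form_act k (l : 'I_5) s :
  weight_form k (TT_act s (PJTS F l)) = (lc_weight k (val \o perm_fun s) (pjts l))%:~R.
Proof. by rewrite PJTS_mono TT_act_mono weight_form_mono ?pjts_tm_ok. Qed.

Lemma eq_lc_weight k f g l : all (fun p => tm_ok p.2) l ->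
  (forall i, (i < 5)%N -> f i = g i) -> lc_weight k f l = lc_weight k g l.
Proof.
move=> + fg; elim: l => //= p l IH /andP[ok /IH ->]; congr (_ * weight k (_, _) + _).
by apply: eq_word_map => i /(tm_ok_lt ok); apply: fg.
Qed.

Lemma weight_form_act0 k (l : 'I_5) s : (k < 5)%N -> val l != k ->
  weight_form k (TT_act s (PJTS F l)) = 0.
Proof.
move=> k5 lk; rewrite weight_form_act.
pose w := map (val \o perm_fun s) (iota 0 5).
have wp : w \in permutations (iota 0 5).
  rewrite mem_permutations; apply: uniq_perm; rewrite ?iota_uniq //.
    rewrite map_inj_in_uniq ?iota_uniq // => i j.
    rewrite !mem_iota => i5 j5 /val_inj.
    exact: perm_fun_inj.
  move=> i; rewrite mem_iota; apply/mapP/idP => [[j _ ->]|i5]; first exact: ltn_ord.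
  exists (val ((s^-1)%g (Ordinal i5))); first by rewrite mem_iota /=.
  by rewrite /= /perm_fun inord_val permKV.
have /allP/(_ _ wp) chk := weight_check.
have := all_iotaP (all_iotaP chk k5) (ltn_ord l); rewrite (negPf lk) /= => /eqP.
rewrite (eq_lc_weight (g := val \o perm_fun s) _ (pjts_tm_ok l)) => [-> //|i i5].
by rewrite (nth_map 0%N) ?size_iota // nth_iota.
Qed.

Hypothesis F_char0 : [pchar F] =i pred0.

Lemma weight_form_neq0 (k : 'I_5) : weight_form k (TT_act 1 (PJTS F k)) != 0.
Proof.
rewrite weight_form_act; apply: intr_neq0 => //.
rewrite (eq_lc_weight (g := id) _ (pjts_tm_ok k)) => [|i i5].
  exact: all_iotaP weight_neq0 (ltn_ord k).
by rewrite /= /perm_fun perm1 inordK.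
Qed.

Lemma PJTS_independent (k : 'I_5) :
  ~ Sn_generated (fun g => exists2 l, l != k & g = PJTS F l) (PJTS F k).
Proof.
move=> gk; have := weight_form_neq0 k.
(* The largest submodule inside the kernel of the form; it contains the four other generators. *)
pose U (t : TT5) := forall s, weight_form k (TT_act s t) = 0.
suff Uk : U (PJTS F k) by rewrite Uk eqxx.
apply: gk => [|_ [l lk ->] s]; last exact: weight_form_act0.
split=> [s|c u v Uu Uv s|s u Uu s'].
- by rewrite /TT_act /weight_form !raddf0.
- by rewrite TT_actP weight_formP Uu Uv mulr0 addr0.
- by rewrite TT_actM.
Qed.

End Independence.

End KernelBasis.

(** * Coordinates, and the rank of an idempotent *)

Section Matrix.

Lemma linear_sumE (F : fieldType) (V W : lmodType F) (h : V -> W) (I : Type)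
    (r : seq I) (c : I -> F) (f : I -> V) :
  linear h -> h (\sum_(i <- r) c i *: f i) = \sum_(i <- r) c i *: h (f i).
Proof.
move=> hl; elim: r => [|i r IH]; last by rewrite !big_cons hl IH.
by rewrite !big_nil; have := hl (-1) 0 0; rewrite scaler0 addr0 scaleN1r addNr.
Qed.

Lemma eq_nf_eval (F : fieldType) (D : dendriformType F) T (x y : T -> D) u :
  x =1 y -> nf_eval x u = nf_eval y u.
Proof. by move=> xy; elim: u => //= [a v ->|a v ->|a v -> w ->]; rewrite xy. Qed.

(** In the model the normal monomials become distinct basis vectors, so [c i] is a coefficient of
    the image of the sum under [h]. *)
Lemma normal_ddmon_free (F : fieldType) n (D : dendriformType F) (x : 'I_n -> D)
    q (bD : q.-tuple (ddmon n)) (c : 'I_q -> F) :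
  free_dendriform x -> uniq bD -> all (@ddmon_normal n) bD ->
  \sum_(i < q) c i *: ddmon_eval x (tnth bD i) = 0 -> forall i, c i = 0.
Proof.
move=> D_free bD_uniq /allP bDn c0 i.
have [h [hm hx _]] := free_dendriform_normal D_free; have [hl _ _] := hm.
have [u iE] := ddmon_normalP (bDn _ (mem_tnth i bD)).
have : h (\sum_(k < q) c k *: ddmon_eval x (tnth bD k)) = 0.
  by rewrite c0; have := hl (-1) 0 0; rewrite scaler0 addr0 scaleN1r addNr.
rewrite linear_sumE // => /(congr1 (mcoeff u)); rewrite mcoeff0 raddf_sum /=.
rewrite (bigD1 i) //= big1 => [|k ki].
  rewrite addr0 mcoeffZ iE ddmon_eval_nf nf_eval_morph //.
  rewrite (eq_nf_eval (y := fun a => nf_mk F (NV a))) // free_dend_eval.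
  by rewrite mcoeffUU mulr1.
have [w kE] := ddmon_normalP (bDn _ (mem_tnth k bD)).
rewrite mcoeffZ kE ddmon_eval_nf nf_eval_morph //.
rewrite (eq_nf_eval (y := fun a => nf_mk F (NV a))) // free_dend_eval mcoeffU.
case: eqP => [wu|_]; last by rewrite mulr0.
by case/eqP: ki; apply: (tuple_uniqP _ bD_uniq); rewrite kE wu.
Qed.

(** Write A = C R with C of full column rank and R of full row rank. Cancelling C and R in C R C R =
    C R leaves R C = 1, an identity matrix of size the rank, and tr (C R) = tr (R C). *)
Lemma rank_idempotent (F : fieldType) n (A : 'M[F]_n) :
  A *m A = A -> \tr A = (\rank A)%:R.
Proof.
move=> AA; rewrite -{1}(mulmx_base A) mxtrace_mulC.
suff -> : row_base A *m col_base A = 1%:M by rewrite mxtrace1.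
apply: (row_full_inj (col_base_full A)); apply: (row_free_inj (row_base_free A)).
by rewrite /= mulmx1 mulmxA -mulmxA !mulmx_base.
Qed.

End Matrix.

(** * The dimension of the nullspace *)

Section Rank.
Variable F : fieldType.
Hypothesis F_char0 : [pchar F] =i pred0.
Variables (D : dendriformType F) (x : 'I_5 -> D).
Hypothesis D_free : free_dendriform x.
Variables (p q : nat) (bT : p.-tuple (ttmon 5)) (bD : q.-tuple (ddmon 5)).
Hypothesis bT_uniq : uniq bT.
Hypothesis bT_P : forall m : ttmon 5, (m \in bT) = ttmon_multilinear m.
Hypothesis bD_uniq : uniq bD.
Hypothesis bD_P :
  forall m : ddmon 5, (m \in bD) = ddmon_multilinear m && ddmon_normal m.
Variable E5 : 'M[F]_(q, p).
Hypothesis E5_P : forall j : 'I_p,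
  expansion x << tnth bT j >> = \sum_(i < q) E5 i j *: ddmon_eval x (tnth bD i).

Definition tt_vec (v : 'cV[F]_p) : {malg F[ttmon 5]} :=
  \sum_(j < p) v j 0 *: << tnth bT j >>.

Lemma tt_vec_TT v : TT (tt_vec v).
Proof. by apply: TT_sum => j _; apply: TTU; rewrite -bT_P mem_tnth. Qed.

Lemma tt_vec_coef v i : (tt_vec v)@_(tnth bT i) = v i 0.
Proof.
rewrite /tt_vec raddf_sum (bigD1 i) //= big1 ?addr0 => [|j ji].
  by rewrite mcoeffZ mcoeffUU mulr1.
rewrite mcoeffZ mcoeffU; case: eqP => [e|_]; last by rewrite mulr0.
by case/eqP: ji; apply: (tuple_uniqP _ bT_uniq).
Qed.

Lemma tt_vec_ker v : E5 *m v = 0 <-> expansion_ker x (tt_vec v).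
Proof.
have vecE : expansion x (tt_vec v) =
    \sum_(i < q) (E5 *m v) i 0 *: ddmon_eval x (tnth bD i).
  rewrite linear_sumE; last exact: lin_ext_is_linear.
  transitivity (\sum_(j < p) \sum_(i < q)
      (E5 i j * v j 0) *: ddmon_eval x (tnth bD i)).
    apply: eq_bigr => j _; rewrite E5_P scaler_sumr; apply: eq_bigr => i _.
    by rewrite scalerA mulrC.
  rewrite exchange_big; apply: eq_bigr => i _ /=.
  by rewrite mxE scaler_suml.
split=> [v0|[_]].
  split; first exact: tt_vec_TT.
  by rewrite vecE v0 big1 // => i _; rewrite mxE scale0r.
rewrite vecE => e; apply/matrixP => i j; rewrite ord1 [RHS]mxE.
apply: (normal_ddmon_free D_free bD_uniq _ e).
by apply/allP => m; rewrite bD_P => /andP[].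
Qed.

Definition proj_mx : 'M[F]_p :=
  \matrix_(i, j) ((scale%:~R)^-1 * (ker_proj << tnth bT j >>)@_(tnth bT i)).

(** No coefficient is lost in passing to the matrix: the values of [ker_proj] lie in the span of the
    generators, hence are multilinear, and so are supported on [bT]. *)
Lemma proj_mx_vec v : tt_vec (proj_mx *m v) = (scale%:~R)^-1 *: ker_proj (tt_vec v).
Proof.
have kTT (t : {malg F[ttmon 5]}) : TT t -> TT (ker_proj t).
  by move=> tt; have [] := PJTS_span_ker D_free (ker_proj_span tt).
apply/malgP => m; have [mb|mb] := boolP (m \in bT); last first.
  have out (u : {malg F[ttmon 5]}) : TT u -> u@_m = 0.
    move=> tu; apply/eqP; rewrite mcoeff_eq0; apply: contra mb => /tu.
    by rewrite bT_P.
  rewrite mcoeffZ !out ?mulr0 //; last exact: tt_vec_TT.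
  exact/kTT/tt_vec_TT.
have /tnthP[i ->] := mb; rewrite tt_vec_coef mxE mcoeffZ.
rewrite [in RHS]/tt_vec linear_sumE; last exact: lin_ext_is_linear.
rewrite raddf_sum mulr_sumr; apply: eq_bigr => j _ /=.
by rewrite mcoeffZ mxE -mulrA [X in _ = _ * X]mulrC.
Qed.

Lemma proj_mx_ker : E5 *m proj_mx = 0.
Proof.
apply/matrixP => i j; rewrite [RHS]mxE.
have /matrixP/(_ i 0) : E5 *m (proj_mx *m delta_mx j 0) = 0 :> 'cV_q.
  apply/tt_vec_ker; rewrite proj_mx_vec.
  have [K0 KP _] := expansion_ker_submodule D_free.
  rewrite -[X in expansion_ker x X]addr0; apply: KP => //.
  by apply: PJTS_span_ker => //; apply: ker_proj_span; apply: tt_vec_TT.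
by rewrite mulmxA -colE !mxE.
Qed.

(** The columns of [B] lie in the kernel, where [ker_proj] is multiplication by [scale]. With
    [proj_mx_ker] this makes [proj_mx] idempotent. *)
Lemma proj_mx_id r (B : 'M[F]_(p, r)) : E5 *m B = 0 -> proj_mx *m B = B.
Proof.
move=> EB; apply/matrixP => i j.
have vk : expansion_ker x (tt_vec (col j B)).
  by apply/tt_vec_ker; rewrite colE mulmxA EB mul0mx.
have := proj_mx_vec (col j B); rewrite (ker_proj_ker D_free vk).
rewrite scalerA mulVf ?scale_neq0 // scale1r => /(congr1 (mcoeff (tnth bT i))).
by rewrite !tt_vec_coef {1}colE mulmxA -colE !mxE.
Qed.

Lemma trace_proj_mx : \tr proj_mx = 335%:R.
Proof.
pose g (m : ttmon 5) : F := (scale%:~R)^-1 * (ker_proj << m >>)@_m.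
have -> : \tr proj_mx = \sum_(m <- bT) g m.
  by rewrite big_tuple; apply: eq_bigr => j _; rewrite mxE.
(* The basis is reordered by type and permutation; by equivariance the diagonal coefficient depends
   on the type alone, so each type counts 120 times. *)
pose L := [seq mon (perm_fun s) (tm_id tau) | tau <- iota 0 12, s <- enum {: 'S_5}].
have bTL : perm_eq bT L.
  apply: uniq_perm => // [|m].
    apply: allpairs_uniq; rewrite ?iota_uniq ?enum_uniq //.
    move=> _ _ /allpairsP[[a b] [a12 _ ->]] /allpairsP[[a' b'] [a12' _ ->]] /= e.
    have {}a12 : (a < 12)%N by move: a12; rewrite mem_iota.
    have {}a12' : (a' < 12)%N by move: a12'; rewrite mem_iota.
    have := congr1 (@ttmon_key 5) e; rewrite !mon_key //= => -[-> e0 e1 e2 e3 e4].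
    congr (_, _); apply/permP => i; rewrite -[i]inord_val; apply: val_inj => /=.
    case: i => [[|[|[|[|[|i]]]]] i5] //=; assumption.
  rewrite bT_P; apply/idP/idP => [/multilinear_mon[tau tau12 [s ->]]|].
    by apply: allpairs_f; rewrite ?mem_iota ?mem_enum.
  case/allpairsP=> [[tau s] [tau12 _ ->]]; apply/mon_perm_multilinear/tm_id_ok.
  by move: tau12; rewrite mem_iota.
rewrite (perm_big _ bTL) /L big_allpairs_dep.
transitivity (\sum_(tau <- iota 0 12) (scale%:~R)^-1 *
    (lc_coef (tm_id tau) (kernel_part tau))%:~R *+ 120 : F).
  rewrite big_seq [RHS]big_seq; apply: eq_bigr => tau; rewrite mem_iota => tau12.
  rewrite (eq_bigr (fun=> (scale%:~R)^-1 *
    (lc_coef (tm_id tau) (kernel_part tau))%:~R)) => [|s _].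
    by rewrite big_enum sumr_const card_Sn.
  rewrite /g ker_proj_mon // mono_coef ?tm_id_ok //.
  exact: all_iotaP kernel_part_ok tau12.
rewrite sumrMnl -mulr_sumr -rmorph_sum /=.
have -> : \sum_(tau <- iota 0 12) lc_coef (tm_id tau) (kernel_part tau) = 804.
  by rewrite -trace_check unlock.
(* What remains is 804 · 120 = 288 · 335. *)
rewrite -mulrnAr; apply: (mulfI (scale_neq0 F_char0)).
rewrite mulrA mulfV ?scale_neq0 // mul1r.
by rewrite /scale -mulr_natr; ring.
Qed.

(** The projection fixes the columns of [cokermx E5], which bounds their rank by its own; conversely
    [E5 *m proj_mx = 0] bounds the rank of [proj_mx] by the nullity of [E5]. *)
Lemma rank_cokermx : \rank (cokermx E5) = 335%N.
Proof.
have PP : proj_mx *m proj_mx = proj_mx by apply/proj_mx_id/proj_mx_ker.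
have -> : \rank (cokermx E5) = \rank proj_mx.
  apply/eqP; rewrite eqn_leq; apply/andP; split.
    rewrite -{1}(proj_mx_id (mulmx_coker E5)); exact: mxrankM_maxl.
  rewrite mxrank_coker -(leq_add2l (\rank E5)) subnKC ?rank_leq_col //.
  exact: mulmx0_rank_max proj_mx_ker.
have := rank_idempotent PP; rewrite trace_proj_mx => /eqP.
rewrite -subr_eq0; have F0 := (pcharf0P F).1 F_char0.
(* So far the rank equals 335 only in F. Subtracting in the order that gives a natural number,
   characteristic zero makes the difference vanish. *)
have [le|lt] := leqP (\rank proj_mx) 335.
  by rewrite -natrB // F0 subn_eq0 => ge; apply/eqP; rewrite eqn_leq le.
by rewrite -oppr_eq0 opprB -natrB 1?ltnW // F0 subn_eq0 leqNgt lt.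
Qed.

End Rank.

Theorem theorem5p2
  (F : fieldType) (F_char0 : [pchar F] =i pred0)
  (D : dendriformType F) (x : 'I_5 -> D) (D_free : free_dendriform x)
  (* the monomial bases of TT_5 and DD_5, in any order; necessarily
     p = 1440 and q = 5040 *)
  (p q : nat)
  (bT : p.-tuple (ttmon 5)) (bT_uniq : uniq bT)
  (bT_P : forall m : ttmon 5, (m \in bT) = ttmon_multilinear m)
  (bD : q.-tuple (ddmon 5)) (bD_uniq : uniq bD)
  (bD_P : forall m : ddmon 5,
     (m \in bD) = ddmon_multilinear m && ddmon_normal m)
  (* column j of E5 holds the coordinates of the image of basis vector j *)
  (E5 : 'M[F]_(q, p))
  (E5_P : forall j : 'I_p,
     expansion x << tnth bT j >>
     = \sum_(i < q) E5 i j *: ddmon_eval x (tnth bD i)) :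
  let vec (v : 'cV[F]_p) : {malg F[ttmon 5]} :=
    \sum_(j < p) v j 0 *: << tnth bT j >> in
  [/\ (* the nullspace of E5 is identified with the kernel of the expansion *)
      forall v : 'cV[F]_p, E5 *m v = 0 <-> expansion_ker x (vec v),
      (* the columns of cokermx E5 span the nullspace {v | E5 *m v = 0} *)
      \rank (cokermx E5) = 335%N,
      forall t : {malg F[ttmon 5]},
        expansion_ker x t <-> Sn_generated (fun g => exists k, g = PJTS F k) t
    & forall k : 'I_5,
        ~ Sn_generated (fun g => exists2 l, l != k & g = PJTS F l) (PJTS F k)].
Proof.
move=> vec; split.
- by move=> v; apply: (tt_vec_ker D_free bT_P bD_uniq bD_P E5_P).
- exact: (rank_cokermx F_char0 D_free bT_uniq bT_P bD_uniq bD_P E5_P).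
- by move=> t; split; [exact: ker_PJTS_span|exact: PJTS_span_ker].
- exact: PJTS_independent.
Qed.
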